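(* Assume that for some $r\in\mathbb N$, $f$ is mixing with rate $\psi_f(N)=L_N^{-\alpha}$, for some $\alpha>0$, on $C^r$; that $\tau$ satisfies the anticoncentration inequality (with the normalizing sequence $(L_N)$); and that $G$ is mixing with rate $\psi_G(\cdot)$ on $C^r$, where $$\int_{\mathbb R^d}\psi_G(t)\,dt<+\infty.$$ Then $F$ is mixing with rate $\psi_F(N):=L_N^{-\min\{d,\alpha\}}$ on $C^w$ for some $w=w(r)\in\mathbb N$.
   Context: Setting. $X,Y$ are compact manifolds, $f:X\to X$ is a smooth map preserving a probability measure $\mu$, $(G_t)_{t\in\mathbb R^d}$ is a smooth $d$-parameter flow ($\mathbb R^d$-action) on $Y$ preserving a probability measure $\nu$, and $\tau:X\to\mathbb R^d$ is smooth. Put $\tau_N(x)=\sum_{n=0}^{N-1}\tau(f^nx)$, $\zeta=\mu\times\nu$, and $F(x,y)=(f(x),G_{\tau(x)}y)$ on $X\times Y$, so $F$ preserves $\zeta$. Mixing rates. $G$ is mixing with rate $\psi(t)$ on a space $\mathbb B$ if there is $C$ such that $\left|\int B_1(y)B_2(G_ty)\,d\nu(y)-\nu(B_1)\nu(B_2)\right|\le C\psi(t)\|B_1\|_{\mathbb B}\|B_2\|_{\mathbb B}$ for all $B_1,B_2\in\mathbb B$ and all $t\in\mathbb R^d$. The same definition applies to the maps $f$ (measure $\mu$) and $F$ (measure $\zeta$), with $t$ replaced by $N\in\mathbb N$ and $G_t$ by the $N$-th iterate. Anticoncentration inequality. Let $(L_n)$ be a sequence of positive reals and $D_n=n\mu(\tau)$,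 and assume that $\frac{\tau_n-D_n}{L_n}$ converges in distribution as $n\to\infty$ to a non-atomic distribution. $\tau$ satisfies the anticoncentration inequality if there is a global constant $C>0$ such that for every unit cube $\mathcal C\subset\mathbb R^d$ and every $N$, $\mu(\{x\in X:\tau_N(x)\in\mathcal C\})\le CL_N^{-d}$. *)

(* Defs.v *)
From HB Require Import structures.
From mathcomp Require Import all_boot all_order all_algebra.
From mathcomp Require Import all_classical all_reals all_analysis.
From mathcomp Require Import measurable_realfun.

Set Implicit Arguments.
Unset Strict Implicit.
Unset Printing Implicit Defensive.

Import Order.TTheory GRing.Theory Num.Theory.
Import numFieldNormedType.Exports.

Local Open Scope classical_set_scope.
Local Open Scope ring_scope.

(* Meaningful for open U only: all iterated partial derivatives of order at
   most k exist and are continuous on U. *)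
Fixpoint Ck_on (R : realType) (n : nat) (W : normedModType R) (k : nat)
    (U : set 'rV[R]_n) (g : 'rV[R]_n -> W) : Prop :=
  (forall v, U v -> {for v, continuous g}) /\
  if k is k'.+1 then
    forall i : 'I_n, (forall v, U v -> derivable g v (delta_mx 0 i)) /\
                     Ck_on k' U ('D_(delta_mx 0 i) g)
  else True.

Definition smooth_on (R : realType) (n : nat) (W : normedModType R)
    (U : set 'rV[R]_n) (g : 'rV[R]_n -> W) : Prop :=
  forall k, Ck_on k U g.

Definition iter_partial (R : realType) (n : nat) (s : seq 'I_n)
    (g : 'rV[R]_n -> R) : 'rV[R]_n -> R :=
  foldr (fun i (h : 'rV[R]_n -> R) => 'D_(delta_mx 0 i) h) g s.

(* [chart_inv i] is only meaningful on the image of [chart_dom i]. *)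
Record atlas (R : realType) (T : topologicalType) (n : nat) := Atlas {
  chart_index : Type;
  chart_dom : chart_index -> set T;
  chart_map : chart_index -> T -> 'rV[R]_n;
  chart_inv : chart_index -> 'rV[R]_n -> T }.
Arguments Atlas {R T n}.
Arguments chart_index {R T n}.
Arguments chart_dom {R T n}.
Arguments chart_map {R T n}.
Arguments chart_inv {R T n}.

Definition smooth_atlas (R : realType) (T : topologicalType) (n : nat)
    (A : atlas R T n) : Prop :=
  [/\ \bigcup_i chart_dom A i = [set: T],
      forall i, open (chart_dom A i) /\
        open (chart_map A i @` chart_dom A i),
      forall i x, chart_dom A i x ->
        chart_inv A i (chart_map A i x) = x,
      forall i x, chart_dom A i x ->
        {for x, continuous (chart_map A i)} /\
        {for chart_map A i x, continuous (chart_inv A i)} &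
      forall i j, smooth_on (chart_map A i @` (chart_dom A i `&` chart_dom A j))
        (chart_map A j \o chart_inv A i)].

Definition compact_manifold (R : realType) (T : topologicalType) (n : nat)
    (A : atlas R T n) : Prop :=
  [/\ hausdorff_space T, compact [set: T] & smooth_atlas A].

Definition euclidean_atlas (R : realType) (n : nat) : atlas R 'rV[R]_n n :=
  Atlas unit (fun=> setT) (fun=> id) (fun=> id).

Definition product_atlas (R : realType) (S T : topologicalType) (m n : nat)
    (A : atlas R S m) (B : atlas R T n) : atlas R (S * T)%type (m + n) :=
  Atlas (chart_index A * chart_index B)%type
    (fun ij => chart_dom A ij.1 `*` chart_dom B ij.2)
    (fun ij z => row_mx (chart_map A ij.1 z.1) (chart_map B ij.2 z.2))
    (fun ij v => (chart_inv A ij.1 (lsubmx v), chart_inv B ij.2 (rsubmx v))).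

Definition smooth_map (R : realType) (S T : topologicalType) (m n : nat)
    (A : atlas R S m) (B : atlas R T n) (f : S -> T) : Prop :=
  continuous f /\
  forall i j,
    smooth_on (chart_map A i @` (chart_dom A i `&` f @^-1` chart_dom B j))
      (chart_map B j \o f \o chart_inv A i).

Definition Cr (R : realType) (T : topologicalType) (n : nat) (A : atlas R T n)
    (r : nat) : set (T -> R) :=
  [set B : T -> R | forall i, Ck_on (W := R) r (chart_map A i @` chart_dom A i)
                      (B \o chart_inv A i)].

(* The C^r norm is computed in finitely many charts, each restricted to a
   compact part of its domain, where the partial derivatives are bounded.
   Two such choices give equivalent norms. *)
Record patches (R : realType) (T : topologicalType) (n : nat)
    (A : atlas R T n) := Patches {
  patch : finType;
  patch_chart : patch -> chart_index A;
  patch_set : patch -> set T }.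
Arguments Patches {R T n A}.
Arguments patch {R T n A}.
Arguments patch_chart {R T n A}.
Arguments patch_set {R T n A}.

Definition patch_cover (R : realType) (T : topologicalType) (n : nat)
    (A : atlas R T n) (P : patches A) : Prop :=
  \bigcup_p patch_set P p = [set: T] /\
  forall p, compact (patch_set P p) /\
            patch_set P p `<=` chart_dom A (patch_chart P p).

Definition product_patches (R : realType) (S T : topologicalType) (m n : nat)
    (A : atlas R S m) (B : atlas R T n) (P : patches A) (Q : patches B) :
    patches (product_atlas A B) :=
  Patches (A := product_atlas A B) (patch P * patch Q)%type
    (fun pq => (patch_chart P pq.1, patch_chart Q pq.2))
    (fun pq => patch_set P pq.1 `*` patch_set Q pq.2).

Definition Cr_norm (R : realType) (T : topologicalType) (n : nat)
    (A : atlas R T n) (P : patches A) (r : nat) (B : T -> R) : R :=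
  sup [set a | exists p (s : seq 'I_n) x,
         [/\ (size s <= r)%N, patch_set P p x &
             a = `|iter_partial s (B \o chart_inv A (patch_chart P p))
                    (chart_map A (patch_chart P p) x)|]].

Definition borel (T : ptopologicalType) := g_sigma_algebraType (@open T).
HB.instance Definition _ (T : ptopologicalType) := Measurable.on (borel T).

Definition cons_rV (R : realType) (n : nat)
    (p : borel 'rV[R]_n * measurableTypeR R) : borel 'rV[R]_n.+1 :=
  row_mx (p.2%:M : 'rV[R]_1) (p.1 : 'rV[R]_n) : 'rV[R]_(1 + n).

Lemma cons_rV0 (R : realType) (n : nat) (p : borel 'rV[R]_n * measurableTypeR R) :
  (cons_rV p : 'rV[R]_n.+1) 0 ord0 = p.2.
Proof.
have -> : ord0 = lshift n (0 : 'I_1) by exact: val_inj.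
by rewrite /cons_rV (row_mxEl (p.2%:M : 'rV[R]_1)) mxE eqxx mulr1n.
Qed.

Lemma cons_rVS (R : realType) (n : nat) (p : borel 'rV[R]_n * measurableTypeR R)
    (j : 'I_n) :
  (cons_rV p : 'rV[R]_n.+1) 0 (lift ord0 j) = (p.1 : 'rV[R]_n) 0 j.
Proof.
have -> : lift ord0 j = rshift 1 j by exact: val_inj.
by rewrite /cons_rV (row_mxEr (p.2%:M : 'rV[R]_1)).
Qed.

Lemma cons_rV_ball (R : realType) (n : nat) (c : 'rV[R]_n.+1) (e : R) :
  0 < e ->
  @cons_rV R n @^-1` ball c e =
  ball (\row_j c 0 (lift ord0 j)) e `*` ball (c 0 ord0) e.
Proof.
move=> e0; apply/seteqP; split=> p.
  move=> [_ H]; split.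
    by split=> // i j; rewrite !ord1 mxE; have := H 0 (lift ord0 j); rewrite cons_rVS.
  by have := H 0 ord0; rewrite cons_rV0.
move=> [[_ Hv] Hx]; split=> // i j; rewrite !ord1.
have [k ->|->] := unliftP ord0 j; last by rewrite cons_rV0.
by rewrite cons_rVS; have := Hv 0 k; rewrite mxE.
Qed.

Lemma open_rV_bigcup (R : realType) (n : nat) (U : set 'rV[R]_n) :
  open U ->
  U = \bigcup_(q : 'rV[rat]_n * nat)
        if `[< ball (map_mx ratr q.1 : 'rV[R]_n) q.2.+1%:R^-1 `<=` U >]
        then ball (map_mx ratr q.1 : 'rV[R]_n) q.2.+1%:R^-1 else set0.
Proof.
move=> oU; apply/seteqP; split=> [v Uv|v [q _]]; last first.
  by case: ifPn => // /asboolP; exact.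
have /nbhs_ballP[e /= e0 veU] : nbhs v U by apply: open_nbhs_nbhs.
have [k] : exists k, 0 + k.+1%:R^-1 < e / 2.
  by apply: ltr_add_invr; rewrite divr_gt0.
rewrite add0r => ke.
have k0 : 0 < k.+1%:R^-1 :> R by rewrite invr_gt0.
have q_ (i : 'I_n) : {q : rat | `|v 0 i - ratr q| < k.+1%:R^-1}.
  apply: cid; have /rat_in_itvoo[q] : v 0 i - k.+1%:R^-1 < v 0 i + k.+1%:R^-1.
    by rewrite ltrBlDr -addrA ltrDl addr_gt0.
  rewrite in_itv /= => /andP[h1 h2]; exists q.
  by rewrite distrC ltr_distl h1 h2.
pose c : 'rV[rat]_n := \row_i sval (q_ i).
have vc : ball (map_mx ratr c : 'rV[R]_n) k.+1%:R^-1 v.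
  split=> // i j; rewrite !ord1 !mxE /ball /= distrC.
  exact: (svalP (q_ j)).
exists (c, k) => //=; case: ifPn => // /asboolP; apply: contra_notP => _.
move=> w cw; apply: veU; have : ball v (k.+1%:R^-1 + k.+1%:R^-1) w.
  by apply: ball_triangle cw; exact: ball_sym.
by apply: le_ball; rewrite [leRHS]splitr lerD // ltW.
Qed.

Lemma measurable_cons_rV (R : realType) (n : nat) :
  measurable_fun setT (@cons_rV R n).
Proof.
apply: measurability; first by [].
move=> _ [U oU <-]; rewrite setTI (open_rV_bigcup (U := U)) // preimage_bigcup.
apply: countable_bigcupT_measurable => // -[c k] /=.
case: ifPn => _; last by rewrite preimage_set0.
rewrite cons_rV_ball; last by rewrite invr_gt0.
apply: measurableX; last by exact: measurable_ball.
by apply: sub_sigma_algebra; apply: ball_open; rewrite invr_gt0.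
Qed.

(* The measure m \x lebesgue_measure, transported to R^(n+1) by cons_rV. *)
Definition lebesgue_cons (R : realType) (n : nat)
    (m : {measure set (borel 'rV[R]_n) -> \bar R}) :
    {measure set (borel 'rV[R]_n.+1) -> \bar R} :=
  measure_function_pushforward__canonical__measure_function_Measure
    (m \x lebesgue_measure)%E (@measurable_cons_rV R n).

Fixpoint lebesgue_rV (R : realType) (n : nat) :
    {measure set (borel 'rV[R]_n) -> \bar R} :=
  if n is n'.+1 return {measure set (borel 'rV[R]_n) -> \bar R} then
    lebesgue_cons (lebesgue_rV R n')
  else \d_((0 : 'rV[R]_0) : borel 'rV[R]_0).

Lemma lebesgue_rV_box (R : realType) (n : nat) (a b : 'rV[R]_n) :
  (forall i, a 0 i <= b 0 i) ->
  lebesgue_rV R n [set v : 'rV[R]_n | forall i, a 0 i <= v 0 i <= b 0 i] =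
  (\prod_(i < n) (b 0 i - a 0 i))%:E.
Proof.
elim: n a b => [|n IH] a b ab.
  rewrite big_ord0 /= diracE mem_set//; by case.
pose tl (c : 'rV[R]_n.+1) : 'rV[R]_n := \row_j c 0 (lift ord0 j).
rewrite big_ord_recl /= /pushforward.
rewrite [X in (_ \x _)%E X](_ : _ =
  [set v : borel 'rV[R]_n | forall i, tl a 0 i <= (v : 'rV[R]_n) 0 i <= tl b 0 i]
  `*` `[a 0 ord0, b 0 ord0]); last first.
  apply/seteqP; split=> p /=.
    move=> H; split=> [i|]; last by rewrite in_itv /= -cons_rV0; exact: H.
    by rewrite !mxE -cons_rVS; exact: H.
  rewrite in_itv /= => -[H0 H1] i.
  have [k ->|->] := unliftP ord0 i; last by rewrite cons_rV0.
  by rewrite cons_rVS; have := H0 k; rewrite !mxE.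
rewrite product_measure1E; [|  |exact: measurable_itv].
- have E := IH (tl a) (tl b); rewrite [X in (X * _)%E]E; last first.
    by move=> i; rewrite !mxE.
  rewrite [X in (_ * X)%E](lebesgue_measure_itv `[a 0 ord0, b 0 ord0]) /= lte_fin.
  have -> : (if a 0 ord0 < b 0 ord0 then ((b 0 ord0)%:E - (a 0 ord0)%:E)%E else 0%E)
     = (b 0 ord0 - a 0 ord0)%:E.
    by case: ltgtP (ab ord0) => // -> _; rewrite subrr.
  by rewrite -EFinM mulrC; congr (_ * _)%:E; apply: eq_bigr => i _; rewrite !mxE.
- rewrite (_ : mkset _ = ~` ~` [set v : 'rV[R]_n |
      forall i, tl a 0 i <= v 0 i <= tl b 0 i]); last by rewrite setCK.
  apply: measurableC; apply: sub_sigma_algebra.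
  rewrite openC.
  rewrite (_ : mkset _ = \bigcap_i
     ((fun v : 'rV[R]_n => v 0 i) @^-1` `[tl a 0 i, tl b 0 i])).
    apply: closed_bigI => i _; apply: preimage_closed => [v _|].
      exact: coord_continuous.
    exact: interval_closed.
  by apply/seteqP; split=> v /= H i; have := H i; rewrite /= in_itv /=; [move=> h _|exact].
Qed.

Definition preserves d (T : measurableType d) (R : realType)
    (m : {measure set T -> \bar R}) (f : T -> T) : Prop :=
  forall A, measurable A -> m (f @^-1` A) = m A.

Definition is_action (R : realType) (d : nat) (Y : Type)
    (G : 'rV[R]_d -> Y -> Y) : Prop :=
  (forall y, G 0 y = y) /\ forall s t y, G (s + t) y = G s (G t y).

Definition birkhoff_sum (R : realType) (d : nat) (X : Type) (f : X -> X)
    (tau : X -> 'rV[R]_d) (N : nat) (x : X) : 'rV[R]_d :=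
  \sum_(n < N) tau (iter n f x).

Definition skew_product (R : realType) (d : nat) (X Y : Type) (f : X -> X)
    (G : 'rV[R]_d -> Y -> Y) (tau : X -> 'rV[R]_d) (z : X * Y) : X * Y :=
  (f z.1, G (tau z.1) z.2).

(* [time] is R^d for an action and nat for the iterates of a map. *)
Definition mixing d (T : measurableType d) (R : realType)
    (m : {measure set T -> \bar R}) (time : Type) (phi : time -> T -> T)
    (rate : time -> R) (B : set (T -> R)) (normB : (T -> R) -> R) : Prop :=
  exists C : R, forall B1 B2 : T -> R, B B1 -> B B2 -> forall t : time,
    `| \int[m]_y (B1 y * B2 (phi t y)) - \int[m]_y B1 y * \int[m]_y B2 y |
      <= C * rate t * normB B1 * normB B2.

Definition mean (R : realType) (d : nat) (X : ptopologicalType)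
    (mu : probability (borel X) R) (tau : X -> 'rV[R]_d) : 'rV[R]_d :=
  \row_j \int[mu]_x tau x 0 j.

Definition cvg_in_distribution (R : realType) (d : nat) (X : ptopologicalType)
    (mu : probability (borel X) R) (Z : nat -> X -> 'rV[R]_d)
    (lam : probability (borel 'rV[R]_d) R) : Prop :=
  forall h : 'rV[R]_d -> R, continuous h ->
    (exists M : R, forall v, `|h v| <= M) ->
    (fun n => \int[mu]_x h (Z n x)) @ \oo --> \int[lam]_v h v.

Definition non_atomic (R : realType) (d : nat)
    (lam : probability (borel 'rV[R]_d) R) : Prop :=
  forall v : 'rV[R]_d, lam [set v] = 0%E.

Definition normalized_limit (R : realType) (d : nat) (X : ptopologicalType)
    (mu : probability (borel X) R) (f : X -> X) (tau : X -> 'rV[R]_d)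
    (L : nat -> R) : Prop :=
  exists2 lam : probability (borel 'rV[R]_d) R, non_atomic lam &
    cvg_in_distribution mu
      (fun n x => (L n)^-1 *: (birkhoff_sum f tau n x - mean mu tau *+ n)) lam.

(* Axis-parallel and closed; the other conventions only change the constant in
   the anticoncentration inequality. *)
Definition unit_cube (R : realType) (d : nat) (a : 'rV[R]_d) : set 'rV[R]_d :=
  [set v | forall j, a 0 j <= v 0 j <= a 0 j + 1].

Definition anticoncentration (R : realType) (d : nat) (X : ptopologicalType)
    (mu : probability (borel X) R) (f : X -> X) (tau : X -> 'rV[R]_d)
    (L : nat -> R) : Prop :=
  exists2 C : R, 0 < C &
    forall (a : 'rV[R]_d) (N : nat),
      (mu [set x | unit_cube a (birkhoff_sum f tau N x)]
         <= (C * L N ^- d)%:E)%E.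

(* Main.v *)
Require Import Defs.
From HB Require Import structures.
From mathcomp Require Import all_boot all_order all_algebra.
From mathcomp Require Import all_classical all_reals all_analysis.
From mathcomp Require Import measurable_realfun ring lra.

Import Order.TTheory GRing.Theory Num.Theory.
Import numFieldNormedType.Exports.

Set Implicit Arguments.
Unset Strict Implicit.
Unset Printing Implicit Defensive.

Local Open Scope classical_set_scope.
Local Open Scope ring_scope.

(** For fixed x, the fibre correlation of B1(x,.) and B2(f^N x,.) at time
    tau_N(x) differs from the product of the fibre means by at most
    C psi(tau_N(x)) |B1| |B2|, by mixing of G.  As composition with
    G_s, for s in a compact set, is bounded on C^r, the same estimate holds with
    psi replaced by its infimum, hence by its integral, over the unit cube
    centred at tau_N(x).  Integrating in x and exchanging the integrals
    (Tonelli) leaves the integral of psi(u) mu(tau_N in a unit cube around u),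
    which is O(L_N^-d) by anticoncentration.  What remains is the correlation of
    the fibre means along f; these means are C^r by differentiation under the
    integral sign, so it is O(L_N^-alpha).  When L_N <= 1 the trivial bound
    2 |B1| |B2| suffices.  One can take w = r. *)

(** * Calculus of C^k functions on R^n *)

(** Integrability of psi says nothing about its value at the random time tau_N(x). Cubes of side 1
    serve as averaging sets because they have volume 1 and anticoncentration is stated for them. The
    bounded factor is uniform in the time since only differences of two times, lying in a fixed cube
    around 0, enter the composition. Three obstacles shape the proof. Smoothness is given by
    continuous partial derivatives in charts, so a total differential has to be built before the
    chain rule. [Cr_norm] is a [sup], which bounds nothing until the set is shown to be bounded. The
    product measure lives on the product of the two Borel sigma-algebras, possibly smaller than the
    Borel sigma-algebra of the product space, so measurability of continuous observables has to be
    proved. No derivative is lost, whence w = r: derivatives of a section along Y, or of a fibre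
    mean along X, come from partial derivatives of the same order on the product, and composing with
    a smooth flow map keeps the order. *)

Lemma for_continuous_sum (R : realType) (T : topologicalType) (I : finType)
    (F : I -> T -> R) (x : T) :
  (forall i, {for x, continuous (F i)}) ->
  {for x, continuous (fun t => \sum_i F i t)}.
Proof.
move=> cF; have -> : (fun t => \sum_i F i t) = \sum_i F i.
  by apply/funext => t; rewrite fct_sumE.
by elim/big_ind : _ => // [|f g cf cg]; [exact: cvg_cst|exact: continuousD].
Qed.

(** The difference quotient along the line at [c] is literally that of [g] at [a + c *: v], so a
    directional derivative alone carries over. *)
Lemma is_derive_line (R : realType) (V : normedModType R) (g : V -> R)
    (a v : V) (c : R) :
  derivable g (a + c *: v) v ->
  is_derive c (1 : R) (fun t : R => g (a + t *: v)) ('D_v g (a + c *: v)).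
Proof.
have E : (fun h : R => h^-1 *: (((fun t : R => g (a + t *: v)) \o shift c)
      (h *: (1 : R)) - g (a + c *: v))) =
    (fun h : R => h^-1 *: ((g \o shift (a + c *: v)) (h *: v)
      - g (a + c *: v))).
  apply/funext => h /=; congr (_ *: (g _ - _)).
  by rewrite scalerDl [h *: 1]mulr1 addrCA.
by move=> dg; apply: DeriveDef; rewrite /derivable /derive E.
Qed.

(** The bound [|c| <= |t|] replaces an interval so that both signs of [t] are covered; for negative
    [t] the mean value theorem is used on [[t, 0]]. *)
Lemma mean_value_line (R : realType) (V : normedModType R) (g : V -> R)
    (a v : V) (t : R) :
  (forall c, `|c| <= `|t| -> derivable g (a + c *: v) v) ->
  exists2 c, `|c| <= `|t| & g (a + t *: v) - g a = t * 'D_v g (a + c *: v).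
Proof.
move=> dg; pose phi (c : R) := g (a + c *: v).
have dphi c : `|c| <= `|t| -> is_derive c (1 : R) phi ('D_v g (a + c *: v)).
  by move=> ct; apply: is_derive_line; exact: dg.
have phi0 : phi 0 = g a by rewrite /phi scale0r addr0.
have cphi x y : (forall c, c \in `[x, y] -> `|c| <= `|t|) ->
    {within `[x, y], continuous phi}.
  move=> xyt; apply: derivable_within_continuous => c /xyt/dphi h.
  exact: ex_derive.
have [t0|t0] := leP 0 t.
  have sub c : c \in `[0, t] -> `|c| <= `|t|.
    by rewrite in_itv /= => /andP[c0 ct]; rewrite !ger0_norm.
  have [c /sub ct] := MVT_segment t0
    (fun c h => dphi c (sub c (subset_itv_oo_cc h))) (cphi _ _ sub).
  by rewrite phi0 subr0 => E; exists c => //; rewrite -/(phi t) E mulrC.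
have sub c : c \in `[t, 0] -> `|c| <= `|t|.
  rewrite in_itv /= => /andP[c0 ct].
  by rewrite ler0_norm// ler0_norm ?lerN2// ltW.
have [c /sub ct] := MVT_segment (ltW t0)
  (fun c h => dphi c (sub c (subset_itv_oo_cc h))) (cphi _ _ sub).
rewrite phi0 sub0r => E; exists c => //.
by rewrite -/(phi t) -opprB E mulrN opprK mulrC.
Qed.

(** Bridge from the epsilon estimates that the mean value theorem delivers to the little-o
    definition of the differential, identified by its uniqueness. *)
Lemma differentiable_epsilon (R : realType) (V W : normedModType R) (f : V -> W)
    (df : {linear V -> W}) (x : V) :
  continuous df ->
  (forall e, 0 < e -> \forall w \near (0 : V),
     `|f (x + w) - f x - df w| <= e * `|w|) ->
  differentiable f x /\ 'd f x = df :> (V -> W).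
Proof.
move=> cdf H.
have E : f \o shift x = cst (f x) + df +o_ 0 id.
  apply/eqaddoP => e e0; apply: filterS (H e e0) => w.
  by rewrite /= !fctE opprD addrA [w + x]addrC.
have dE : 'd f x = df :> (V -> W) by apply: diff_unique.
by split=> //; apply/diff_locallyP; rewrite dE.
Qed.

Lemma ler_norm_coord (R : realType) n (v : 'rV[R]_n) i : `|v 0 i| <= `|v|.
Proof.
rewrite [leRHS]/Num.Def.normr/= mx_normrE.
exact: (le_bigmax _ (fun ij : 'I_1 * 'I_n => `|v ij.1 ij.2|) (0, i)).
Qed.

Lemma norm_rV_le (R : realType) n (v : 'rV[R]_n) (M : R) :
  0 <= M -> (forall i, `|v 0 i| <= M) -> `|v| <= M.
Proof.
move=> M0 vM; rewrite [leLHS]/Num.Def.normr/= mx_normrE.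
by apply: bigmax_le => // -[i j] _; rewrite ord1.
Qed.

Definition gradient_form (R : realType) n (g : 'rV[R]_n -> R) (a : 'rV[R]_n)
  (w : 'rV[R]_n) : R := \sum_j w 0 j * 'D_(delta_mx 0 j) g a.

Lemma gradient_form_linear (R : realType) n (g : 'rV[R]_n -> R) a :
  linear (gradient_form g a).
Proof.
move=> k u v; rewrite /gradient_form scaler_sumr -big_split /=.
by apply: eq_bigr => j _; rewrite !mxE mulrDl -mulrA.
Qed.

(* The increment is split along the coordinates and each piece is handled by
   the one-variable mean value theorem. *)
Lemma C1_increment (R : realType) n (g : 'rV[R]_n -> R) (a : 'rV[R]_n) :
  (forall j : 'I_n, \forall v \near a, derivable g v (delta_mx 0 j)) ->
  (forall j : 'I_n, {for a, continuous ('D_(delta_mx 0 j) g)}) ->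
  forall e, 0 < e -> \forall w \near (0 : 'rV[R]_n),
    `|g (a + w) - g a - gradient_form g a w| <= e * `|w|.
Proof.
move=> dg cg e e0.
(* Each of the [n] coordinate moves gets the share [e']; the divisor [n.+1] stays positive when
   [n = 0]. *)
pose e' := e / n.+1%:R; have e'0 : 0 < e' by rewrite divr_gt0.
have : \forall v \near a, forall j : 'I_n,
    derivable g v (delta_mx 0 j) /\
    `|'D_(delta_mx 0 j) g v - 'D_(delta_mx 0 j) g a| <= e'.
  apply: (filter_forall (F := nbhs a) (f := fun (j : 'I_n) v =>
    derivable g v (delta_mx 0 j) /\
    `|'D_(delta_mx 0 j) g v - 'D_(delta_mx 0 j) g a| <= e')) => j.
  apply: filterI; first exact: (dg j).
  have /cvgrPdist_le/(_ _ e'0) := cg j.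
  by apply: filterS => v /=; rewrite distrC.
move=> /nbhs_ballP[r /= r0 Hr].
near=> w.
have wr : `|w| < r.
  by near: w; apply/nbhs_ballP; exists r => //= w; rewrite -ball_normE /= sub0r normrN.
(* Truncations of [w]: passing from [h k] to [h k.+1] moves along one axis only. Truncating does not
   increase the sup norm, so the whole path stays in the ball. *)
pose h (k : nat) : 'rV[R]_n := \row_j (if (j < k)%N then w 0 j else 0).
have hn : h n = w by apply/rowP => j; rewrite mxE ltn_ord.
have h0 : h 0%N = 0 by apply/rowP => j; rewrite !mxE.
have hS (k : 'I_n) : h k.+1 = h k + w 0 k *: delta_mx 0 k.
  apply/rowP => j; rewrite !mxE ltnS leq_eqVlt eqxx /=.
  have [->|jk] := eqVneq j k; first by rewrite eqxx ltnn mulr1 add0r.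
  by rewrite -(inj_eq val_inj) in jk; rewrite (negbTE jk) /= mulr0 addr0.
have inball (k : 'I_n) (c : R) : `|c| <= `|w 0 k| ->
    ball a r (a + h k + c *: delta_mx 0 k).
  move=> cw; rewrite -ball_normE /= -addrA opprD addNKr normrN.
  apply: le_lt_trans wr; apply: norm_rV_le => // j; rewrite !mxE eqxx /=.
  have [->|jk] := eqVneq j k; last by rewrite mulr0 addr0; case: ifP => _;
    [exact: ler_norm_coord|rewrite normr0].
  by rewrite ltnn add0r mulr1; exact: le_trans cw (ler_norm_coord _ _).
have step (k : 'I_n) : `|g (a + h k.+1) - g (a + h k)
    - w 0 k * 'D_(delta_mx 0 k) g a| <= e' * `|w|.
  have [|c cw E] := @mean_value_line _ _ g (a + h k) (delta_mx 0 k) (w 0 k).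
    by move=> c /inball /Hr /(_ k) [].
  rewrite hS addrA E -mulrBr normrM mulrC.
  apply: ler_pM => //; last exact: ler_norm_coord.
  by have /Hr/(_ k)[] := inball k c cw.
have -> : g (a + w) - g a - gradient_form g a w =
    \sum_(k < n) (g (a + h k.+1) - g (a + h k) - w 0 k * 'D_(delta_mx 0 k) g a).
  rewrite sumrB; congr (_ - _).
  rewrite -(big_mkord predT (fun k => g (a + h k.+1) - g (a + h k))).
  by rewrite telescope_sumr// hn h0 addr0.
apply: (le_trans (ler_norm_sum _ _ _)).
apply: (le_trans (ler_sum _ (fun k _ => step k))).
rewrite sumr_const card_ord -mulr_natl mulrA ler_wpM2r//.
rewrite /e' mulrCA ler_piMr ?(ltW e0)//.
by rewrite ler_pdivrMr// mul1r ler_nat.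
Unshelve. all: by end_near. Qed.

Lemma C1_differentiable (R : realType) n (g : 'rV[R]_n -> R) (a : 'rV[R]_n) :
  (forall j : 'I_n, \forall v \near a, derivable g v (delta_mx 0 j)) ->
  (forall j : 'I_n, {for a, continuous ('D_(delta_mx 0 j) g)}) ->
  differentiable g a /\ 'd g a = gradient_form g a :> ('rV[R]_n -> R).
Proof.
move=> dg cg.
pose gM := GRing.isLinear.Build _ _ _ _ _ (gradient_form_linear g a).
pose G : {linear 'rV[R]_n -> R} := HB.pack (gradient_form g a) gM.
have cG : continuous G.
  move=> w; apply: for_continuous_sum => j.
  apply: continuousM; [exact: coord_continuous|]. exact: cst_continuous.
exact: (differentiable_epsilon cG (C1_increment dg cg)).
Qed.

(** Restricting to the curve [t |-> H (u + t *: e)] leaves one real variable, where derivability of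
    the coordinates already gives differentiability. The chain rule for differentials at 0 then
    applies. *)
Lemma derive_comp_C1 (R : realType) (V : normedModType R) m
    (g : 'rV[R]_m -> R) (H : V -> 'rV[R]_m) (u e : V) :
  (forall j : 'I_m, \forall v \near H u, derivable g v (delta_mx 0 j)) ->
  (forall j : 'I_m, {for H u, continuous ('D_(delta_mx 0 j) g)}) ->
  (forall j : 'I_m, derivable (fun v => H v 0 j) u e) ->
  derivable (g \o H) u e /\
  'D_e (g \o H) u =
    \sum_j 'D_(delta_mx 0 j) g (H u) * 'D_e (fun v => H v 0 j) u.
Proof.
move=> dg cg dH.
have [diffg gE] := C1_differentiable dg cg.
pose gam (t : R) : 'rV[R]_m := H (u + t *: e).
have gam0 : gam 0 = H u by rewrite /gam scale0r addr0.
have dgamj j : is_derive (0 : R) (1 : R) (fun t => gam t 0 j)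
    ('D_e (fun v => H v 0 j) u).
  have := @is_derive_line _ _ (fun v => H v 0 j) u e 0.
  by rewrite scale0r addr0; exact.
have dgam : derivable gam 0 1.
  apply/derivable_mxP => i j; rewrite ord1; by case: (dgamj j).
have diffgam : differentiable gam 0 by apply/derivable1_diffP.
have diffg' : differentiable g (gam 0) by rewrite gam0.
have dcomp : derivable (g \o H) u e.
  apply/derivable1P/derivable1_diffP.
  have -> : (fun h : R => (g \o H) (h *: e + u)) = g \o gam.
    by apply/funext => h; rewrite /gam /= addrC.
  exact: differentiable_comp.
split=> //.
have := @is_derive_line _ _ (g \o H) u e 0.
rewrite scale0r addr0 => /(_ dcomp) [_ <-].
rewrite -[fun t => _]/(g \o gam) deriveE; last exact: differentiable_comp.
rewrite diff_comp// /comp gam0 gE /gradient_form.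
apply: eq_bigr => j _; rewrite mulrC; congr (_ * _).
by rewrite -deriveE// derive_mx// mxE derive_val.
Qed.

Lemma derivable_mx_coord (R : realType) (V : normedModType R) m
    (H : V -> 'rV[R]_m) (u e : V) (j : 'I_m) :
  derivable H u e ->
  derivable (fun v => H v 0 j) u e /\
  'D_e (fun v => H v 0 j) u = ('D_e H u) 0 j.
Proof.
by move=> dH; split; [exact: ((derivable_mxP H u e).1 dH 0 j)|
  rewrite derive_mx// mxE].
Qed.

(** * Jets: sums of iterated partial derivatives *)

Section Ck.
Variables (R : realType) (n : nat).
Implicit Types (U V : set 'rV[R]_n) (g h : 'rV[R]_n -> R) (k : nat).

(** The sum of the absolute values of all iterated partials of order at most [k], one term per
    sequence of indices. This pointwise l^1 form suits induction on the order and is continuous in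
    [v]; [Cr_norm] is a supremum of the same terms. *)
Fixpoint jet_norm k g (v : 'rV[R]_n) : R :=
  `|g v| + if k is k'.+1 then \sum_i jet_norm k' ('D_(delta_mx 0 i) g) v else 0.

Lemma jet_norm_ge0 k g v : 0 <= jet_norm k g v.
Proof.
elim: k g => [|k IH] g /=; first by rewrite addr0.
by rewrite addr_ge0// sumr_ge0.
Qed.

Lemma jet_normS k g v : jet_norm k g v <= jet_norm k.+1 g v.
Proof.
elim: k g => [|k IH] g; first by rewrite /= addr0 lerDl sumr_ge0// => i _; rewrite addr0.
by rewrite [leLHS]/= [leRHS]/=; rewrite lerD2l; apply: ler_sum => i _; exact: IH.
Qed.

Lemma ler_norm_jet k g v : `|g v| <= jet_norm k g v.
Proof.
by case: k => [|k] /=; rewrite lerDl// sumr_ge0// => i _; exact: jet_norm_ge0.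
Qed.

Lemma ler_derive_jet k g v i :
  jet_norm k ('D_(delta_mx 0 i) g) v <= jet_norm k.+1 g v.
Proof.
rewrite [leRHS]/= (bigD1 i)//= addrCA lerDl addr_ge0// sumr_ge0// => j _.
exact: jet_norm_ge0.
Qed.

(** The last index is the innermost derivative, the one that [jet_norm] takes first; inductions
    therefore split sequences at their right end. *)
Lemma iter_partial_rcons s i g :
  iter_partial (rcons s i) g = iter_partial s ('D_(delta_mx 0 i) g).
Proof. by rewrite /iter_partial foldr_rcons. Qed.

Lemma ler_iter_partial_jet k s g v :
  (size s <= k)%N -> `|iter_partial s g v| <= jet_norm k g v.
Proof.
elim: k g s => [|k IH] g s; first by case: s => //=; rewrite addr0.
case: (lastP s) => [_|s' i]; first exact: ler_norm_jet.
rewrite size_rcons ltnS iter_partial_rcons => /IH h.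
exact: le_trans (h _) (ler_derive_jet _ _ _ _).
Qed.

(** The constant counts the terms: there are [n ^ i] index sequences of length [i]. *)
Lemma jet_norm_le_iter_partial k g v (M : R) :
  (forall s : seq 'I_n, (size s <= k)%N -> `|iter_partial s g v| <= M) ->
  jet_norm k g v <= (\sum_(i < k.+1) n%:R ^+ i) * M.
Proof.
elim: k g => [|k IH] g HM.
  by rewrite /= big_ord1 expr0 mul1r addr0; exact: (HM [::]).
rewrite [leLHS]/= big_ord_recl expr0 mulrDl mul1r lerD//; first exact: (HM [::]).
under [in leRHS]eq_bigr do rewrite exprS.
rewrite -mulr_sumr -mulrA mulr_natl -[X in _ *+ X]card_ord -sumr_const.
apply: ler_sum => i _; apply: IH => s sk; rewrite -iter_partial_rcons.
by apply: HM; rewrite size_rcons ltnS.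
Qed.

End Ck.

Lemma near_eq_continuous (S T : topologicalType) (f g : S -> T) (x : S) :
  (\forall y \near x, f y = g y) ->
  {for x, continuous f} -> {for x, continuous g}.
Proof.
move=> fg; rewrite /prop_for /continuous_at -(nbhs_singleton fg) => cf.
by apply: cvg_trans cf; apply: near_eq_cvg; apply: filterS fg => y ->.
Qed.

Section Ck_on.
Variables (R : realType) (n : nat).
Implicit Types (U V : set 'rV[R]_n) (k : nat).

Lemma Ck_on_sub (W : normedModType R) k U V (g : 'rV[R]_n -> W) :
  V `<=` U -> Ck_on k U g -> Ck_on k V g.
Proof.
elim: k g => [|k IH] g VU /= [cg dg]; split=> //; [by move=> v /VU/cg|
  by move=> v /VU/cg|].
by move=> i; have [? ?] := dg i; split; [move=> v /VU; auto|exact: IH].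
Qed.

(** The set [V] may be any set containing the point, because [Ck_on] only makes pointwise assertions
    on its set about derivatives taken in the ambient space. *)
Lemma Ck_on_local (W : normedModType R) k U (g : 'rV[R]_n -> W) :
  (forall v, U v -> exists2 V, V v & Ck_on k V g) -> Ck_on k U g.
Proof.
elim: k g => [|k IH] g H /=.
  by split=> // v /H[V Vv [cg _]]; exact: cg.
split=> [v /H[V Vv [cg _]]|i]; first exact: cg.
split=> [v /H[V Vv [_ /(_ i)[dg _]]]|]; first exact: dg.
by apply: IH => v /H[V Vv [_ /(_ i)[_ dg]]]; exists V.
Qed.

Lemma Ck_onW (W : normedModType R) k U (g : 'rV[R]_n -> W) :
  Ck_on k.+1 U g -> Ck_on k U g.
Proof.
elim: k g => [|k IH] g [cg dg]; first by [].
by split=> // i; have [? ?] := dg i; split=> //; exact: IH.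
Qed.

Lemma open_near U (v : 'rV[R]_n) (P : 'rV[R]_n -> Prop) :
  open U -> U v -> (forall w, U w -> P w) -> \forall w \near v, P w.
Proof. by move=> oU Uv HP; apply: filterS HP _; exact: open_nbhs_nbhs. Qed.

Lemma Ck_on_eq (W : normedModType R) k U (g h : 'rV[R]_n -> W) :
  open U -> (forall v, U v -> g v = h v) -> Ck_on k U g -> Ck_on k U h.
Proof.
elim: k g h => [|k IH] g h oU gh [cg dg]; split=> //;
  have gh_near v : U v -> \forall w \near v, g w = h w;
  try by move=> Uv; exact: (open_near oU Uv).
- by move=> v Uv; apply: near_eq_continuous (cg v Uv); exact: gh_near.
- by move=> v Uv; apply: near_eq_continuous (cg v Uv); exact: gh_near.
move=> i; have [dgi Cgi] := dg i; split=> [v Uv|].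
  by apply: near_eq_derivable (dgi v Uv); exact: gh_near.
apply: IH Cgi => // v Uv.
by apply: near_eq_derive; exact: gh_near.
Qed.

Lemma jet_norm_eq k U (g h : 'rV[R]_n -> R) v :
  open U -> (forall v, U v -> g v = h v) -> U v ->
  jet_norm k g v = jet_norm k h v.
Proof.
elim: k g h => [|k IH] g h oU gh Uv /=; rewrite gh//; congr (_ + _).
apply: eq_bigr => i _; apply: IH => // w Uw.
have gh_near : \forall w \near w, g w = h w by exact: (open_near oU Uw).
exact: near_eq_derive.
Qed.

Lemma Ck_on_cst k U (c : R) : Ck_on (W := R) k U (fun=> c).
Proof.
elim: k U c => [|k IH] U c /=; split=> //.
- by move=> v _; exact: cst_continuous.
- by move=> v _; exact: cst_continuous.
move=> i; split=> [v _|]; first exact: derivable_cst.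
have -> : 'D_(delta_mx 0 i) (fun=> c) = fun _ : 'rV[R]_n => 0 :> R.
  by apply/funext => v; exact: derive_cst.
exact: IH.
Qed.

Lemma jet_norm0 k v : jet_norm k (fun _ : 'rV[R]_n => 0 : R) v = 0.
Proof.
elim: k => [|k IH] /=; first by rewrite normr0 addr0.
rewrite normr0 add0r big1// => i _.
rewrite (_ : 'D__ _ = fun=> 0)//.
by apply/funext => w; exact: derive_cst.
Qed.

Lemma Ck_onD k U (g h : 'rV[R]_n -> R) : open U ->
  Ck_on (W := R) k U g -> Ck_on (W := R) k U h ->
  Ck_on (W := R) k U (fun v => g v + h v) /\
  forall v, U v ->
    jet_norm k (fun v => g v + h v) v <= jet_norm k g v + jet_norm k h v.
Proof.
move=> oU; elim: k g h => [|k IH] g h [cg dg] [ch dh].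
  split; last by move=> v Uv /=; rewrite !addr0 ler_normD.
  by split=> // v Uv; apply: continuousD; auto.
have E i v : U v -> 'D_(delta_mx 0 i) g v + 'D_(delta_mx 0 i) h v =
    'D_(delta_mx 0 i) (fun v => g v + h v) v.
  by move=> Uv; rewrite -deriveD//; [exact: (dg i).1|exact: (dh i).1].
split.
  split=> [v Uv|i]; first by apply: continuousD; auto.
  split=> [v Uv|].
    by apply: derivableD; [exact: (dg i).1|exact: (dh i).1].
  by apply: (Ck_on_eq oU (E i)); exact: (IH _ _ (dg i).2 (dh i).2).1.
move=> v Uv /=; rewrite addrACA lerD ?ler_normD// -big_split /=.
apply: ler_sum => i _; rewrite -(jet_norm_eq k oU (E i) Uv).
exact: (IH _ _ (dg i).2 (dh i).2).2.
Qed.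

Lemma Ck_on_sum k U (I : finType) (g : I -> 'rV[R]_n -> R) : open U ->
  (forall i, Ck_on (W := R) k U (g i)) ->
  Ck_on (W := R) k U (fun v => \sum_i g i v) /\
  forall v, U v -> jet_norm k (fun v => \sum_i g i v) v <=
    \sum_i jet_norm k (g i) v.
Proof.
move=> oU Cg; elim: (index_enum I) => [|i s [IH1 IH2]].
  split=> [|v Uv].
    by rewrite (_ : (fun _ => _) = fun=> 0); [exact: Ck_on_cst|
      apply/funext => v; rewrite big_nil].
  rewrite (_ : (fun _ => _) = fun=> 0); first by rewrite jet_norm0 big_nil.
  by apply/funext => w; rewrite big_nil.
have [C J] := Ck_onD oU (Cg i) IH1.
rewrite (_ : (fun _ => _) = fun v => g i v + \sum_(i <- s) g i v); last first.
  by apply/funext => w; rewrite big_cons.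
split=> // v Uv; rewrite big_cons.
by apply: (le_trans (J v Uv)); rewrite lerD2l IH2.
Qed.

(** By induction through the Leibniz rule; each order of differentiation doubles the constant. *)
Lemma Ck_onM k U (g h : 'rV[R]_n -> R) : open U ->
  Ck_on (W := R) k U g -> Ck_on (W := R) k U h ->
  Ck_on (W := R) k U (fun v => g v * h v) /\
  forall v, U v -> jet_norm k (fun v => g v * h v) v <=
    2 ^+ k * (jet_norm k g v * jet_norm k h v).
Proof.
move=> oU; elim: k g h => [|k IH] g h Cg Ch.
  case: Cg Ch => [cg _] [ch _].
  split; last by move=> v Uv /=; rewrite !addr0 expr0 mul1r normrM.
  by split=> // v Uv; apply: continuousM; auto.
have [Cg' Ch'] := (Ck_onW Cg, Ck_onW Ch).
case: Cg Ch => [cg dg] [ch dh].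
have E i v : U v -> g v * 'D_(delta_mx 0 i) h v + h v * 'D_(delta_mx 0 i) g v =
    'D_(delta_mx 0 i) (fun v => g v * h v) v.
  by move=> Uv; rewrite deriveM//; [exact: (dg i).1|exact: (dh i).1].
have P i := IH _ _ Cg' (dh i).2.
have Q i := IH _ _ Ch' (dg i).2.
have S i := Ck_onD oU (P i).1 (Q i).1.
split.
  split=> [v Uv|i]; first by apply: continuousM; auto.
  split=> [v Uv|].
    by apply: derivableM; [exact: (dg i).1|exact: (dh i).1].
  by apply: (Ck_on_eq oU (E i)); exact: (S i).1.
move=> v Uv.
have -> : jet_norm k.+1 (fun v => g v * h v) v = `|g v| * `|h v| +
    \sum_i jet_norm k (fun v => g v * 'D_(delta_mx 0 i) h v +
      h v * 'D_(delta_mx 0 i) g v) v.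
  rewrite /= normrM; congr (_ + _); apply: eq_bigr => i _.
  by rewrite (jet_norm_eq k oU (E i) Uv).
set A := \sum_i jet_norm k ('D_(delta_mx 0 i) g) v.
set B := \sum_i jet_norm k ('D_(delta_mx 0 i) h) v.
have gE : jet_norm k.+1 g v = `|g v| + A by [].
have hE : jet_norm k.+1 h v = `|h v| + B by [].
have A0 : 0 <= A by apply: sumr_ge0 => i _; exact: jet_norm_ge0.
have B0 : 0 <= B by apply: sumr_ge0 => i _; exact: jet_norm_ge0.
have bnd : \sum_i jet_norm k (fun v => g v * 'D_(delta_mx 0 i) h v +
      h v * 'D_(delta_mx 0 i) g v) v <=
    2 ^+ k * ((`|g v| + A) * B + (`|h v| + B) * A).
  rewrite mulrDr -gE -hE [in leRHS]/A [in leRHS]/B.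
  rewrite !mulr_sumr -big_split /=; apply: ler_sum => i _.
  apply: (le_trans ((S i).2 v Uv)); apply: lerD.
    apply: (le_trans ((P i).2 v Uv)); rewrite ler_wpM2l ?exprn_ge0//.
    by rewrite ler_wpM2r ?jet_norm_ge0 ?jet_normS.
  apply: (le_trans ((Q i).2 v Uv)); rewrite ler_wpM2l ?exprn_ge0//.
  by rewrite ler_wpM2r ?jet_norm_ge0 ?jet_normS.
apply: (le_trans (lerD (lexx _) bnd)); rewrite gE hE.
have c1 : 1 <= 2 ^+ k :> R by rewrite exprn_ege1// ler1n.
rewrite exprS -mulrA.
clear bnd gE hE; clearbody A B.
move: (2 ^+ k : R) c1 (normr_ge0 (g v)) (normr_ge0 (h v)) A0 B0 => c c1.
move: `|g v| `|h v| A B => a b x y a0 b0 x0 y0.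
have c0 : 0 <= c by apply: le_trans c1.
(* The two sides carry the same multiple of [x * y], which cancels: this is what the factor 2 pays
   for. The remaining terms are nonnegative, [c >= 1] serving for [a * b]. *)
rewrite -subr_ge0.
have -> : 2 * (c * ((a + x) * (b + y))) -
    (a * b + c * ((a + x) * y + (b + y) * x)) =
    (c - 1) * (a * b) + c * (a * b) + c * (x * b) + c * (a * y) by ring.
by rewrite !addr_ge0// ?mulr_ge0// subr_ge0.
Qed.

End Ck_on.

Lemma Ck_on_continuous (R : realType) n (W : normedModType R) k
    (U : set 'rV[R]_n) (g : 'rV[R]_n -> W) :
  Ck_on k U g -> forall v, U v -> {for v, continuous g}.
Proof. by case: k => [|k] [cg _]. Qed.

Lemma continuous_rV (R : realType) (T : topologicalType) n (f : T -> 'rV[R]_n)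
    (x : T) :
  (forall j, {for x, continuous (fun t => f t 0 j)}) -> {for x, continuous f}.
Proof.
move=> cf; apply/cvgrPdist_le => e e0.
have : \forall t \near x, forall j : 'I_n, `|f x 0 j - f t 0 j| <= e.
  apply: (filter_forall (F := nbhs x) (f := fun (j : 'I_n) t =>
    `|f x 0 j - f t 0 j| <= e)) => j.
  by have /cvgrPdist_le/(_ _ e0) := cf j.
apply: filterS => t H; apply: norm_rV_le; first exact: ltW.
by move=> j; rewrite !mxE; exact: H.
Qed.

Lemma continuous_row_mx (R : realType) (T : topologicalType) m n
    (f : T -> 'rV[R]_m) (g : T -> 'rV[R]_n) (x : T) :
  {for x, continuous f} -> {for x, continuous g} ->
  {for x, continuous (fun t => row_mx (f t) (g t))}.
Proof.
move=> cf cg; apply: continuous_rV => j; have [i ->|i ->] := split_ordP j.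
  rewrite (_ : (fun _ => _) = (fun v : 'rV[R]_m => v 0 i) \o f); last first.
    by apply/funext => q /=; rewrite row_mxEl.
  exact: (continuous_comp cf (@coord_continuous R 1 m 0 i _)).
rewrite (_ : (fun _ => _) = (fun v : 'rV[R]_n => v 0 i) \o g); last first.
  by apply/funext => q /=; rewrite row_mxEr.
exact: (continuous_comp cg (@coord_continuous R 1 n 0 i _)).
Qed.

Lemma jet_norm_continuous (R : realType) n k (U : set 'rV[R]_n)
    (g : 'rV[R]_n -> R) :
  Ck_on (W := R) k U g ->
  forall v, U v -> {for v, continuous (jet_norm k g)}.
Proof.
elim: k g => [|k IH] g [cg dg] v Uv.
  rewrite (_ : jet_norm 0 g = fun v => `|g v|); last first.
    by apply/funext => w /=; rewrite addr0.
  exact: (cvg_norm (cg v Uv)).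
apply: (@continuousD _ _ _ (fun v => `|g v|)).
  exact: (cvg_norm (cg v Uv)).
apply: for_continuous_sum => i.
exact: (IH _ (dg i).2 v Uv).
Qed.

Lemma Ck_on_coord (R : realType) n m k (U : set 'rV[R]_n)
    (H : 'rV[R]_n -> 'rV[R]_m) j :
  open U -> Ck_on k U H -> Ck_on (W := R) k U (fun v => H v 0 j).
Proof.
move=> oU; elim: k H => [|k IH] H [cH dH];
  have cHj v : U v -> {for v, continuous (fun v => H v 0 j)}
    by move=> Uv; exact: (continuous_comp (cH v Uv) (@coord_continuous R 1 m 0 j _)).
  by [].
split=> //.
move=> i; split=> [v Uv|].
  by have [] := derivable_mx_coord j ((dH i).1 v Uv).
apply: (Ck_on_eq oU (g := fun v => ('D_(delta_mx 0 i) H v) 0 j)); last first.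
  by apply: IH; exact: (dH i).2.
by move=> v Uv; have [_ ->] := derivable_mx_coord j ((dH i).1 v Uv).
Qed.

(** The order of quantifiers is the point: [C] depends on the dimensions, [k] and [M] only, so one
    constant serves a whole family of inner maps with bounded jets, such as the flow maps for times
    in a compact set. The bound is linear in the jet of [g]. *)
Lemma Ck_on_comp (R : realType) n m k (M : R) : 0 <= M ->
  exists2 C, 0 <= C &
  forall (U : set 'rV[R]_n) (V : set 'rV[R]_m) g (H : 'rV[R]_n -> 'rV[R]_m),
    open U -> open V -> Ck_on (W := R) k V g ->
    (forall j, Ck_on (W := R) k U (fun u => H u 0 j)) ->
    (forall u, U u -> V (H u)) ->
    Ck_on (W := R) k U (g \o H) /\
    forall u, U u -> (forall j, jet_norm k (fun u => H u 0 j) u <= M) ->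
      jet_norm k (g \o H) u <= C * jet_norm k g (H u).
Proof.
move=> M0.
have cgH (U : set 'rV[R]_n) (V : set 'rV[R]_m) (g : _ -> R)
    (H : 'rV[R]_n -> 'rV[R]_m) :
    (forall v, V v -> {for v, continuous g}) ->
    (forall j u, U u -> {for u, continuous (fun u => H u 0 j)}) ->
    (forall u, U u -> V (H u)) ->
    forall u, U u -> {for u, continuous (g \o H)}.
  move=> cg cH UV u Uu; apply: continuous_comp; last by apply: cg; exact: UV.
  by apply: continuous_rV => j; exact: cH.
elim: k => [|k [C C0 IH]].
  exists 1 => // U V g H oU oV [cg _] cH UV; split.
    by split=> //; apply: (cgH _ V) => // j u Uu; have [+ _] := cH j; exact.
  by move=> u Uu _ /=; rewrite !addr0 mul1r.
(* The 1 is for the undifferentiated term; each of the [n] directions costs the product constant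
   [2 ^+ k], with [C] for the outer derivative and [M] for the inner one. *)
exists (1 + n%:R * (2 ^+ k * (C * M))).
  by rewrite addr_ge0// mulr_ge0// mulr_ge0 ?exprn_ge0// mulr_ge0.
move=> U V g H oU oV [cg dg] CH UV.
have CH' j : Ck_on (W := R) k U (fun u => H u 0 j) by apply: Ck_onW.
have dcomp i u : U u -> derivable (g \o H) u (delta_mx 0 i) /\
    'D_(delta_mx 0 i) (g \o H) u = \sum_j 'D_(delta_mx 0 j) g (H u) *
      'D_(delta_mx 0 i) (fun v => H v 0 j) u.
  move=> Uu; apply: derive_comp_C1.
  - by move=> j; apply: (open_near oV (UV u Uu)) => v; exact: (dg j).1.
  - by move=> j; exact: (Ck_on_continuous (dg j).2 (UV u Uu)).
  - by move=> j; have [_ /(_ i)[+ _]] := CH j; exact.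
have P j := IH U V _ H oU oV (dg j).2 CH' UV.
have Q i j := Ck_onM oU (P j).1 ((CH j).2 i).2.
have S i := Ck_on_sum oU (fun j => (Q i j).1).
have E i u : U u -> \sum_j ('D_(delta_mx 0 j) g \o H) u *
    'D_(delta_mx 0 i) (fun v => H v 0 j) u = 'D_(delta_mx 0 i) (g \o H) u.
  by move=> Uu; rewrite (dcomp i u Uu).2.
split.
  split; first by apply: (cgH _ V) => // j u Uu; have [+ _] := CH j; exact.
  move=> i; split=> [u Uu|]; first exact: (dcomp i u Uu).1.
  by apply: (Ck_on_eq oU (E i)); exact: (S i).1.
move=> u Uu HM.
have J i : jet_norm k ('D_(delta_mx 0 i) (g \o H)) u <=
    2 ^+ k * (C * M) * jet_norm k.+1 g (H u).
  rewrite -(jet_norm_eq k oU (E i) Uu).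
  apply: (le_trans ((S i).2 u Uu)).
  apply: (@le_trans _ _ (\sum_j 2 ^+ k * (C * M) *
      jet_norm k ('D_(delta_mx 0 j) g) (H u))).
    apply: ler_sum => j _; apply: (le_trans ((Q i j).2 u Uu)).
    rewrite -mulrA ler_wpM2l ?exprn_ge0// mulrAC.
    apply: ler_pM; rewrite ?jet_norm_ge0//.
      by apply: (P j).2 => // j'; exact: le_trans (jet_normS _ _ _) (HM j').
    apply: le_trans (HM j).
    exact: (ler_derive_jet k (fun u => H u 0 j)).
  rewrite -mulr_sumr ler_wpM2l ?mulr_ge0 ?exprn_ge0//.
  by rewrite /= lerDr.
rewrite mulrDl mul1r; apply: lerD; first exact: (ler_norm_jet k.+1 g).
apply: (le_trans (ler_sum _ (fun i _ => J i))).
by rewrite sumr_const card_ord -[leLHS]mulr_natl -[leRHS]mulrA.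
Qed.

(** * Restriction to slices of a product of Euclidean spaces *)

Section slices.
Variables (R : realType) (m n : nat) (W : normedModType R).
Implicit Types (h : 'rV[R]_(m + n) -> W) (v : 'rV[R]_m) (u : 'rV[R]_n).

Lemma row_mx_rshift (t : R) v u (i : 'I_n) :
  t *: delta_mx 0 (rshift m i) + row_mx v u =
  row_mx v (t *: delta_mx 0 i + u).
Proof.
apply/rowP => j; have [k ->|k ->] := split_ordP j.
  by rewrite row_mxEl mxE row_mxEl !mxE eqxx eq_lrshift mulr0 add0r.
by rewrite row_mxEr mxE row_mxEr !mxE eqxx eq_rshift.
Qed.

Lemma row_mx_lshift (t : R) v u (i : 'I_m) :
  t *: delta_mx 0 (lshift n i) + row_mx v u =
  row_mx (t *: delta_mx 0 i + v) u.
Proof.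
apply/rowP => j; have [k ->|k ->] := split_ordP j.
  by rewrite row_mxEl mxE row_mxEl !mxE eqxx eq_lshift.
by rewrite row_mxEr mxE row_mxEr !mxE eqxx eq_rlshift mulr0 add0r.
Qed.

Lemma derive_rshift h v u (i : 'I_n) :
  'D_(delta_mx 0 (rshift m i)) h (row_mx v u) =
    'D_(delta_mx 0 i) (fun u => h (row_mx v u)) u /\
  (derivable h (row_mx v u) (delta_mx 0 (rshift m i)) =
    derivable (fun u => h (row_mx v u)) u (delta_mx 0 i)).
Proof.
rewrite /derive /derivable.
have -> : (fun t : R => t^-1 *: ((h \o shift (row_mx v u))
      (t *: delta_mx 0 (rshift m i)) - h (row_mx v u))) =
    (fun t : R => t^-1 *: (((fun u => h (row_mx v u)) \o shift u)
      (t *: delta_mx 0 i) - h (row_mx v u))).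
  by apply/funext => t /=; rewrite row_mx_rshift.
by [].
Qed.

Lemma derive_lshift h v u (i : 'I_m) :
  'D_(delta_mx 0 (lshift n i)) h (row_mx v u) =
    'D_(delta_mx 0 i) (fun v => h (row_mx v u)) v /\
  (derivable h (row_mx v u) (delta_mx 0 (lshift n i)) =
    derivable (fun v => h (row_mx v u)) v (delta_mx 0 i)).
Proof.
rewrite /derive /derivable.
have -> : (fun t : R => t^-1 *: ((h \o shift (row_mx v u))
      (t *: delta_mx 0 (lshift n i)) - h (row_mx v u))) =
    (fun t : R => t^-1 *: (((fun v => h (row_mx v u)) \o shift v)
      (t *: delta_mx 0 i) - h (row_mx v u))).
  by apply/funext => t /=; rewrite row_mx_lshift.
by [].
Qed.

Lemma Ck_on_slice k (U : set 'rV[R]_(m + n)) h v :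
  Ck_on k U h ->
  Ck_on k [set u | U (row_mx v u)] (fun u => h (row_mx v u)).
Proof.
have cr u : {for u, continuous (row_mx v : 'rV[R]_n -> 'rV[R]_(m + n))}.
  by apply: continuous_row_mx; [exact: cst_continuous|exact: cvg_id].
elim: k h => [|k IH] h [ch dh] /=; split=> //.
- by move=> u Uu; exact: (continuous_comp (cr u) (ch _ Uu)).
- by move=> u Uu; exact: (continuous_comp (cr u) (ch _ Uu)).
move=> i; split=> [u Uu|].
  by rewrite -(derive_rshift h v u i).2; exact: (dh (rshift m i)).1.
rewrite (_ : 'D__ _ = fun u => 'D_(delta_mx 0 (rshift m i)) h (row_mx v u)).
  exact: (IH _ (dh (rshift m i)).2).
by apply/funext => u; rewrite (derive_rshift h v u i).1.
Qed.

End slices.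

Section slices_real.
Variables (R : realType) (m n : nat).
Implicit Types (h : 'rV[R]_(m + n) -> R) (v : 'rV[R]_m) (u : 'rV[R]_n).

(** Partials of a slice are partials of the joint function along shifted indices, hence among those
    that the norm on the product counts. *)
Lemma iter_partial_rshift h v u (s : seq 'I_n) :
  iter_partial (map (@rshift m n) s) h (row_mx v u) =
  iter_partial s (fun u => h (row_mx v u)) u.
Proof.
elim: s u => [//|i s IH] u /=.
by rewrite (derive_rshift _ v u i).1; congr (derive _ _ _); apply/funext => w.
Qed.

Lemma iter_partial_lshift h v u (s : seq 'I_m) :
  iter_partial (map (@lshift m n) s) h (row_mx v u) =
  iter_partial s (fun v => h (row_mx v u)) v.
Proof.
elim: s v => [//|i s IH] v /=.
by rewrite (derive_lshift _ v u i).1; congr (derive _ _ _); apply/funext => w.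
Qed.

Lemma jet_norm_slice k h v u :
  jet_norm k (fun u => h (row_mx v u)) u <= jet_norm k h (row_mx v u).
Proof.
elim: k h => [|k IH] h //=; rewrite lerD2l big_split_ord /=.
apply: (@le_trans _ _ (\sum_(i < n)
    jet_norm k ('D_(delta_mx 0 (rshift m i)) h) (row_mx v u))); last first.
  by rewrite lerDr sumr_ge0// => i _; exact: jet_norm_ge0.
apply: ler_sum => i _.
rewrite (_ : 'D__ _ = fun u => 'D_(delta_mx 0 (rshift m i)) h (row_mx v u)).
  exact: (IH ('D_(delta_mx 0 (rshift m i)) h)).
by apply/funext => w; rewrite (derive_rshift h v w i).1.
Qed.

End slices_real.

(** * Integrals depending on a parameter *)

(** Near-covering compactness applied to the filter of bounds [M] going to infinity: near [x], any
    [M >= |g x| + 1] works. *)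
Lemma compact_continuous_bounded (R : realType) (T : topologicalType)
    (K : set T) (g : T -> R) :
  compact K -> (forall x, K x -> {for x, continuous g}) ->
  exists2 M, 0 <= M & forall x, K x -> `|g x| <= M.
Proof.
move=> /compact_near_coveringP cK cg.
have H : \forall M \near +oo, forall x, K x -> `|g x| <= M.
  apply: (cK _ (pinfty_nbhs R) (fun M x => `|g x| <= M)) => x Kx.
  near=> y M.
  have gy : `|g x - g y| <= 1.
    by near: y; have /cvgrPdist_le := cg x Kx; apply.
  have gM : `|g x| + 1 <= M by near: M; exact: nbhs_pinfty_ge.
  apply: le_trans gM; rewrite -lerBlDl; apply: le_trans gy.
  by rewrite distrC; exact: lerB_dist.
have [M [M0 HM]] : exists M : R, 0 <= M /\ forall x, K x -> `|g x| <= M.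
  apply: (@filter_ex _ (pinfty_nbhs R)); apply: filterI H.
  exact: nbhs_pinfty_ge.
by exists M.
Unshelve. all: by end_near. Qed.

Lemma continuous_borel_measurable (R : realType) (T : ptopologicalType)
    (g : T -> R) :
  continuous g -> measurable_fun [set: borel T] g.
Proof.
move=> /continuousP cg; apply: (measurability _ (RGenOpens.measurableE R)).
move=> _ [_ [a [b ->] <-]]; rewrite setTI.
by apply: sub_sigma_algebra; apply: cg; exact: interval_open.
Qed.

Section bounded_integrals.
Variables (R : realType) (d : measure_display) (T : measurableType d).
Variable P : probability T R.
Implicit Types f g : T -> R.

Lemma bounded_integrable f (M : R) :
  measurable_fun setT f -> (forall x, `|f x| <= M) ->
  P.-integrable setT (EFin \o f).
Proof.
move=> mf fM; apply: measurable_bounded_integrable => //.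
  by apply: (le_lt_trans (probability_le1 P measurableT)); rewrite ltry.
exists M; split; first exact: num_real.
by move=> x Mx y _ /=; exact: le_trans (fM y) (ltW Mx).
Qed.

Lemma ler_norm_Rintegral f (M : R) :
  measurable_fun setT f -> (forall x, `|f x| <= M) ->
  `|\int[P]_x f x| <= M.
Proof.
move=> mf fM; have fi := bounded_integrable mf fM.
apply: (le_trans (le_normr_Rintegral _ fi)) => //.
have -> : M = \int[P]_x (fun=> M) x.
  have E : \int[P]_x (fun=> M) x = M * fine (P setT) by exact: Rintegral_cst.
  by rewrite E probability_setT mulr1.
apply: le_Rintegral => //.
  apply: (@bounded_integrable (fun x => `|f x|) M); first exact: measurableT_comp.
  by move=> x; rewrite normr_id.
by apply: (@bounded_integrable (cst M) `|M|) => // x; rewrite /=.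
Qed.

Lemma ler_dist_Rintegral f g (M N e : R) :
  measurable_fun setT f -> (forall x, `|f x| <= M) ->
  measurable_fun setT g -> (forall x, `|g x| <= N) ->
  (forall x, `|f x - g x| <= e) ->
  `|\int[P]_x f x - \int[P]_x g x| <= e.
Proof.
move=> mf fM mg gN fge.
rewrite -RintegralB//; [|exact: bounded_integrable fM|exact: bounded_integrable gN].
by apply: ler_norm_Rintegral => //; exact: measurable_funB.
Qed.

End bounded_integrals.

(** A tube lemma: joint continuity along the compact fibre over [s0] gives a neighbourhood of [s0]
    that serves all [y] at once. Uniform closeness of integrands follows, without dominated
    convergence. *)
Lemma tube (R : realType) (S Y : topologicalType) (c : S -> Y -> R) (s0 : S) :
  compact [set: Y] ->
  (forall y, {for (s0, y), continuous (fun p => c p.1 p.2)}) ->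
  forall e, 0 < e -> \forall s \near s0, forall y, `|c s0 y - c s y| <= e.
Proof.
move=> /compact_near_coveringP cY cc e e0.
suff : \forall s \near s0, setT `<=` (fun y => `|c s0 y - c s y| <= e).
  by apply: filterS => s H y; exact: H.
apply: (cY _ (nbhs s0) (fun s y => `|c s0 y - c s y| <= e)) => y _.
have e2 : 0 < e / 2 by rewrite divr_gt0.
have /cvgrPdist_le/(_ _ e2)[[A B] /= [As By] AB] := cc y.
exists (B, A) => // -[y' s] /= [By' As'].
rewrite (splitr e) -(subrKA (c s0 y)).
apply: (le_trans (ler_normD _ _)); apply: lerD.
  rewrite distrC; apply: (AB (s0, y')); split=> //=; exact: nbhs_singleton As.
exact: (AB (s, y')).
Qed.

Section under_integral.
Variables (R : realType) (Y : ptopologicalType) (nu : probability (borel Y) R).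
Hypothesis cY : compact [set: Y].

Lemma section_continuous (S : topologicalType) (c : S -> Y -> R) (s : S) :
  (forall y, {for (s, y), continuous (fun p => c p.1 p.2)}) ->
  continuous (c s).
Proof.
move=> cc y; apply/cvgrPdist_le => e e0.
have /cvgrPdist_le/(_ _ e0)[[A B] /= [As By] AB] := cc y.
by apply: filterS By => y' By'; apply: (AB (s, y')); split=> //=; exact: nbhs_singleton As.
Qed.

Lemma compact_bounded_fun (g : Y -> R) :
  continuous g -> exists2 M, 0 <= M & forall y, `|g y| <= M.
Proof.
move=> cg; have [M M0 HM] := compact_continuous_bounded cY (fun y _ => cg y).
by exists M => // y; exact: HM.
Qed.

Lemma continuous_Rintegral_dist (f g : Y -> R) (e : R) :
  continuous f -> continuous g -> (forall y, `|f y - g y| <= e) ->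
  `|\int[nu]_y f y - \int[nu]_y g y| <= e.
Proof.
move=> cf cg.
have [M M0 HM] := compact_bounded_fun cf.
have [N N0 HN] := compact_bounded_fun cg.
apply: (ler_dist_Rintegral nu (M := M) (N := N)) => //;
  exact: continuous_borel_measurable.
Qed.

(** Joint continuity is asked near [s0], not only over it, so that the neighbouring sections are
    continuous and thus integrable. *)
Lemma continuous_under_integral (S : topologicalType) (c : S -> Y -> R) (s0 : S) :
  (\forall s \near s0, forall y, {for (s, y), continuous (fun p => c p.1 p.2)}) ->
  {for s0, continuous (fun s => \int[nu]_y c s y)}.
Proof.
move=> cc; have cc0 := nbhs_singleton cc.
apply/cvgrPdist_le => e e0; have near_s0 := tube cY cc0 e0.
near=> s; apply: continuous_Rintegral_dist.
- exact: section_continuous.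
- by apply: section_continuous; near: s.
- by near: s.
Unshelve. all: by end_near. Qed.

(** The mean value theorem writes the difference quotient at [y] as the partial derivative at an
    intermediate point depending on [y]; the tube lemma makes that derivative close to the one at
    [v] uniformly in [y]. *)
Lemma derive_under_integral n (b : 'rV[R]_n -> Y -> R) (U : set 'rV[R]_n)
    (v : 'rV[R]_n) (i : 'I_n) :
  open U -> U v ->
  (forall w y, U w -> {for (w, y), continuous (fun p => b p.1 p.2)}) ->
  (forall w y, U w -> derivable (b^~ y) w (delta_mx 0 i)) ->
  (forall w y, U w -> {for (w, y),
     continuous (fun p => 'D_(delta_mx 0 i) (b^~ p.2) p.1)}) ->
  derivable (fun v => \int[nu]_y b v y) v (delta_mx 0 i) /\
  'D_(delta_mx 0 i) (fun v => \int[nu]_y b v y) v =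
    \int[nu]_y 'D_(delta_mx 0 i) (b^~ y) v.
Proof.
move=> oU Uv cb db cdb.
pose c w y := 'D_(delta_mx 0 i) (b^~ y) w.
suff H : (fun h : R => h^-1 *: (((fun v => \int[nu]_y b v y) \o shift v)
      (h *: delta_mx 0 i) - \int[nu]_y b v y)) @ 0^' -->
    (\int[nu]_y c v y : R).
  by split; [apply/cvg_ex; exists (\int[nu]_y c v y)|exact: cvg_lim H].
apply/cvgrPdist_le => e e0.
have : \forall w \near v, U w /\ forall y, `|c v y - c w y| <= e.
  apply: filterI; first exact: open_nbhs_nbhs.
  exact: (tube cY (fun y => cdb v y Uv) e0).
move=> /nbhs_ballP[r /= r0 Hr].
near=> h.
have h0 : h != 0 by near: h; exact: nbhs_dnbhs_neq.
have hr : `|h| < r by near: h; exact: dnbhs0_lt.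
have inball (t : R) : `|t| <= `|h| -> ball v r (v + t *: delta_mx 0 i).
  move=> th; rewrite -ball_normE /= opprD addNKr normrN.
  apply: le_lt_trans hr; apply: norm_rV_le => // j; rewrite !mxE eqxx /=.
  by case: eqP; rewrite ?mulr1 ?mulr0 ?normr0.
have Uh : U (v + h *: delta_mx 0 i) by have /Hr[] := inball h (lexx _).
have cbw w : U w -> continuous (b w).
  by move=> Uw; apply: section_continuous => y; exact: cb.
have [M M0 HM] := compact_bounded_fun (cbw _ Uh).
have [N N0 HN] := compact_bounded_fun (cbw _ Uv).
have mb w : U w -> measurable_fun [set: borel Y] (b w).
  by move=> Uw; apply: continuous_borel_measurable; exact: cbw.
have -> : h^-1 *: (((fun v => \int[nu]_y b v y) \o shift v)
      (h *: delta_mx 0 i) - \int[nu]_y b v y) =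
    \int[nu]_y (h^-1 * (b (v + h *: delta_mx 0 i) y - b v y)).
  rewrite /= [h *: _ + v]addrC [LHS]/GRing.scale /= RintegralZl//.
    congr (_ * _); rewrite RintegralB//.
      by apply: (bounded_integrable nu (M := M)) => //; exact: mb.
    by apply: (bounded_integrable nu (M := N)) => //; exact: mb.
  apply: (bounded_integrable nu (M := M + N)
    (f := fun y : borel Y => b (v + h *: delta_mx 0 i) y - b v y)).
    by apply: measurable_funB; exact: mb.
  by move=> y; apply: (le_trans (ler_normB _ _)); exact: lerD.
apply: continuous_Rintegral_dist.
- by apply: section_continuous => y; exact: cdb.
- move=> y; apply: cvgM; first exact: cvg_cst.
  by apply: cvgB; exact: cbw.
move=> y.
have [|t th ->] := @mean_value_line _ _ (b^~ y) v (delta_mx 0 i) h.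
  by move=> t /inball/Hr[Ut _]; exact: db.
rewrite mulKf//; exact: (Hr _ (inball t th)).2.
Unshelve. all: by end_near. Qed.

(** C^k in [v], with all these partials jointly continuous in [(v, y)]; [y] is only a topological
    parameter. The set [O] allows localisation to one chart domain of Y at a time. *)
Fixpoint joint_Ck n (k : nat) (U : set 'rV[R]_n) (O : set Y)
    (b : 'rV[R]_n -> Y -> R) : Prop :=
  (forall v y, U v -> O y -> {for (v, y), continuous (fun p => b p.1 p.2)}) /\
  if k is k'.+1 then
    forall i : 'I_n,
      (forall v y, U v -> O y -> derivable (b^~ y) v (delta_mx 0 i)) /\
      joint_Ck k' U O (fun v y => 'D_(delta_mx 0 i) (b^~ y) v)
  else True.

Lemma joint_Ck_cover n k (U : set 'rV[R]_n) b :
  (forall y, exists2 O, O y & joint_Ck k U O b) -> joint_Ck k U setT b.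
Proof.
elim: k b => [|k IH] b H.
  by split=> // v y Uv _; have [A Ay [cb _]] := H y; exact: cb.
split=> [v y Uv _|i]; first by have [A Ay [cb _]] := H y; exact: cb.
split=> [v y Uv _|]; first by have [A Ay [_ /(_ i)[db _]]] := H y; exact: db.
by apply: IH => y; have [A Ay [_ /(_ i)[_ db]]] := H y; exists A.
Qed.

Lemma joint_Ck_eq n k (U : set 'rV[R]_n) (O : set Y) b b' : open O ->
  (forall v y, O y -> b v y = b' v y) ->
  joint_Ck k U O b -> joint_Ck k U O b'.
Proof.
move=> oO.
have cE (b1 b2 : 'rV[R]_n -> Y -> R) : (forall v y, O y -> b1 v y = b2 v y) -> forall v y, O y ->
    {for (v, y), continuous (fun p => b1 p.1 p.2)} ->
    {for (v, y), continuous (fun p => b2 p.1 p.2)}.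
  move=> E v y Oy; apply: near_eq_continuous; exists (setT, O).
    by split; [exact: filterT|exact: open_nbhs_nbhs].
  by move=> [w z] /= [_ Oz]; exact: E.
elim: k b b' => [|k IH] b b' E [cb db].
  by split=> // v y Uv Oy; apply: (cE b b') => //; exact: cb.
have bE y : O y -> b^~ y = b'^~ y by move=> Oy; apply/funext => v; exact: E.
split=> [v y Uv Oy|i]; first by apply: (cE b b') => //; exact: cb.
split=> [v y Uv Oy|].
  by rewrite -bE//; exact: (db i).1.
by apply: IH (db i).2 => v y Oy; rewrite bE.
Qed.

(** Only the first block of variables is differentiated, so the chart [phi] of Y enters through its
    continuity alone. *)
Lemma joint_Ck_pullback m n k (W : set 'rV[R]_(m + n)) h (phi : Y -> 'rV[R]_n)
    (U : set 'rV[R]_m) (O : set Y) :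
  (forall y, O y -> {for y, continuous phi}) ->
  (forall v y, U v -> O y -> W (row_mx v (phi y))) ->
  Ck_on (W := R) k W h -> joint_Ck k U O (fun v y => h (row_mx v (phi y))).
Proof.
move=> cphi UO.
have cr v y : O y -> {for (v, y),
    continuous (fun p => row_mx p.1 (phi p.2) : 'rV[R]_(m + n))}.
  move=> Oy; apply: continuous_row_mx; first exact: cvg_fst.
  by apply: continuous_comp; [exact: cvg_snd|exact: cphi].
elim: k h => [|k IH] h [ch dh] /=.
  split=> // v y Uv Oy.
  exact: (continuous_comp (cr v y Oy) (ch _ (UO _ _ Uv Oy))).
split=> [v y Uv Oy|i].
  exact: (continuous_comp (cr v y Oy) (ch _ (UO _ _ Uv Oy))).
split=> [v y Uv Oy|].
  by rewrite -(derive_lshift h v (phi y) i).2; apply: (dh (lshift n i)).1; exact: UO.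
rewrite (_ : (fun _ _ => _) = fun v y =>
    'D_(delta_mx 0 (lshift n i)) h (row_mx v (phi y))).
  exact: (IH _ (dh (lshift n i)).2).
by apply/funext => v; apply/funext => y; rewrite (derive_lshift h v (phi y) i).1.
Qed.

Lemma iter_partial_eq n (U : set 'rV[R]_n) (s : seq 'I_n) (g h : 'rV[R]_n -> R) v :
  open U -> (forall v, U v -> g v = h v) -> U v ->
  iter_partial s g v = iter_partial s h v.
Proof.
move=> oU gh; elim: s v => [|i s IH] v Uv /=; first exact: gh.
by apply: near_eq_derive; apply: (open_near oU Uv) => w; exact: IH.
Qed.

(** Continuity in [y] of the iterated partials is part of the conclusion because the norm of a fibre
    mean is bounded by integrating them, which requires measurability. *)
Lemma Ck_under_integral n k (U : set 'rV[R]_n) (b : 'rV[R]_n -> Y -> R) :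
  open U -> joint_Ck k U setT b ->
  Ck_on (W := R) k U (fun v => \int[nu]_y b v y) /\
  forall s v, U v -> (size s <= k)%N ->
    continuous (fun y => iter_partial s (b^~ y) v) /\
    iter_partial s (fun v => \int[nu]_y b v y) v =
    \int[nu]_y iter_partial s (b^~ y) v.
Proof.
move=> oU.
have ci (b' : 'rV[R]_n -> Y -> R) : (forall v y, U v -> setT y ->
      {for (v, y), continuous (fun p => b' p.1 p.2)}) ->
    forall v, U v -> {for v, continuous (fun v => \int[nu]_y b' v y)}.
  move=> cb v Uv; apply: continuous_under_integral.
  by apply: (open_near oU Uv) => w Uw y; exact: cb.
elim: k b => [|k IH] b [cb db].
  split; first by split=> //; exact: ci.
  move=> [|//] v Uv _; split=> //.
  by apply: section_continuous => y; exact: cb.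
have D i v : U v -> derivable (fun v => \int[nu]_y b v y) v (delta_mx 0 i) /\
    'D_(delta_mx 0 i) (fun v => \int[nu]_y b v y) v =
    \int[nu]_y 'D_(delta_mx 0 i) (b^~ y) v.
  move=> Uv; apply: (derive_under_integral oU Uv).
  - by move=> w y Uw; exact: cb.
  - by move=> w y Uw; exact: (db i).1.
  - move=> w y Uw; have [_ Hi] := db i.
    by case: k Hi {IH db} => [|k] [+ _]; exact.
have Q i := IH _ (db i).2.
split.
  split=> [|i]; first exact: ci.
  split=> [v Uv|]; first exact: (D i v Uv).1.
  apply: (Ck_on_eq oU _ (Q i).1) => v Uv; exact/esym/(D i v Uv).2.
move=> s v Uv; case: (lastP s) => [_|s' i].
  by split=> //; apply: section_continuous => y; exact: cb.
rewrite size_rcons ltnS => sk; rewrite iter_partial_rcons.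
under eq_fun do rewrite iter_partial_rcons.
have [c1 <-] := (Q i).2 s' v Uv sk.
split; last by rewrite (iter_partial_eq s' oU (fun w Uw => (D i w Uw).2) Uv).
exact: c1.
Qed.

End under_integral.

(** * C^r norms on manifolds *)

(** The properties of an atlas that the C^r norm estimates rest on; they pass to product atlases
    directly. *)
Definition charted (R : realType) (T : topologicalType) (n : nat)
    (A : atlas R T n) : Prop :=
  [/\ \bigcup_i chart_dom A i = [set: T],
      forall i, open (chart_dom A i) /\
        open (chart_map A i @` chart_dom A i),
      forall i x, chart_dom A i x ->
        chart_inv A i (chart_map A i x) = x &
      forall i x, chart_dom A i x -> {for x, continuous (chart_map A i)}].

Lemma smooth_atlas_charted (R : realType) (T : topologicalType) (n : nat)
    (A : atlas R T n) : smooth_atlas A -> charted A.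
Proof.
by case=> [cA oA iA mA _]; split=> // i x /mA[].
Qed.

Lemma product_charted (R : realType) (S T : topologicalType) (m n : nat)
    (A : atlas R S m) (B : atlas R T n) :
  charted A -> charted B -> charted (product_atlas A B).
Proof.
move=> [cA oA iA mA] [cB oB iB mB]; split.
- apply/seteqP; split=> // -[x y] _.
  have : [set: S] x by []. rewrite -cA => -[i _ xi].
  have : [set: T] y by []. rewrite -cB => -[j _ yj].
  by exists (i, j).
- move=> [i j]; split.
    rewrite openE => -[x y] [/= xi yj].
    exists (chart_dom A i, chart_dom B j) => //.
    by split; apply: open_nbhs_nbhs; split=> //; [exact: (oA i).1|exact: (oB j).1].
  have -> : chart_map (product_atlas A B) (i, j) @`
      chart_dom (product_atlas A B) (i, j) =
    lsubmx @^-1` (chart_map A i @` chart_dom A i) `&`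
    rsubmx @^-1` (chart_map B j @` chart_dom B j).
    apply/seteqP; split=> [_ [[x y] [/= xi yj] <-]|w /= [[x xi xE] [y yj yE]]].
      by split; rewrite /preimage /= ?row_mxKl ?row_mxKr; [exists x|exists y].
    by exists (x, y) => //=; rewrite xE yE hsubmxK.
  apply: openI; apply: open_comp => //.
  - by move=> w _; exact: continuous_lsubmx.
  - exact: (oA i).2.
  - by move=> w _; exact: continuous_rsubmx.
  - exact: (oB j).2.
- by move=> [i j] [x y] [/= xi yj]; rewrite row_mxKl row_mxKr iA ?iB.
move=> [i j] [x y] [/= xi yj].
apply: continuous_row_mx.
  by apply: (@continuous_comp _ _ _ fst (chart_map A i)); [exact: cvg_fst|exact: mA].
by apply: (@continuous_comp _ _ _ snd (chart_map B j)); [exact: cvg_snd|exact: mB].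
Qed.

Lemma product_patch_cover (R : realType) (S T : topologicalType) (m n : nat)
    (A : atlas R S m) (B : atlas R T n) (P : patches A) (Q : patches B) :
  patch_cover P -> patch_cover Q -> patch_cover (product_patches P Q).
Proof.
move=> [cP hP] [cQ hQ]; split.
  apply/seteqP; split=> // -[x y] _.
  have : [set: S] x by []. rewrite -cP => -[i _ xi].
  have : [set: T] y by []. rewrite -cQ => -[j _ yj].
  by exists (i, j).
move=> [p q]; split; first by apply: compact_setX; [exact: (hP p).1|exact: (hQ q).1].
by move=> [x y] [/= xp yq]; split=> /=; [exact: (hP p).2|exact: (hQ q).2].
Qed.

Section Cr_norm.
Variables (R : realType) (T : topologicalType) (n : nat) (A : atlas R T n).
Variables (P : patches A) (r : nat).
Hypotheses (cA : charted A) (hP : patch_cover P).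
Implicit Type B : T -> R.

Lemma patch_of x : exists p, patch_set P p x.
Proof.
by have : [set: T] x by []; rewrite -hP.1 => -[p _ px]; exists p.
Qed.

(** Jets are continuous and patches compact. This makes the [sup] in [Cr_norm] a genuine supremum
    instead of the default value 0 of an unbounded set. *)
Lemma Cr_norm_bounded B : Cr A r B -> exists M, forall p (s : seq 'I_n) x,
  (size s <= r)%N -> patch_set P p x ->
  `|iter_partial s (B \o chart_inv A (patch_chart P p))
     (chart_map A (patch_chart P p) x)| <= M.
Proof.
move=> CB; case: cA => _ _ _ mA.
have H p : exists M, 0 <= M /\ forall x, patch_set P p x ->
    jet_norm r (B \o chart_inv A (patch_chart P p))
      (chart_map A (patch_chart P p) x) <= M.
  have [x px|M M0 HM] := @compact_continuous_bounded R _ (patch_set P p)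
    (jet_norm r (B \o chart_inv A (patch_chart P p)) \o
      chart_map A (patch_chart P p)) (hP.2 p).1.
    have dx := (hP.2 p).2 x px.
    apply: continuous_comp; first exact: mA.
    by apply: (jet_norm_continuous (CB (patch_chart P p))); exists x.
  exists M; split=> // x px; apply: le_trans (HM x px).
  exact: ler_norm.
have [M HM] := choice H.
exists (\sum_p M p) => p s x sr px.
apply: (le_trans (ler_iter_partial_jet _ _ sr)).
apply: (le_trans ((HM p).2 x px)).
by rewrite (bigD1 p)//= lerDl sumr_ge0// => q _; exact: (HM q).1.
Qed.

Lemma ler_Cr_norm B p (s : seq 'I_n) x :
  Cr A r B -> (size s <= r)%N -> patch_set P p x ->
  `|iter_partial s (B \o chart_inv A (patch_chart P p))
     (chart_map A (patch_chart P p) x)| <= Cr_norm P r B.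
Proof.
move=> CB sr px; have [M HM] := Cr_norm_bounded CB.
apply: ub_le_sup; last by exists p, s, x.
by exists M => _ [q [s' [y [s'r qy ->]]]]; exact: HM.
Qed.

(** The point [x0] provides an element of the set, as [ge_sup] asks for a nonempty one. *)
Lemma Cr_norm_le (x0 : T) B (M : R) :
  (forall p (s : seq 'I_n) x, (size s <= r)%N -> patch_set P p x ->
  `|iter_partial s (B \o chart_inv A (patch_chart P p))
     (chart_map A (patch_chart P p) x)| <= M) -> Cr_norm P r B <= M.
Proof.
move=> HM; apply: ge_sup.
  have [p px] := patch_of x0.
  by eexists; exists p, [::], x0; split.
by move=> _ [q [s' [y [s'r qy ->]]]]; exact: HM.
Qed.

Lemma ler_norm_Cr_norm B x : Cr A r B -> `|B x| <= Cr_norm P r B.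
Proof.
move=> CB; have [p px] := patch_of x.
have := ler_Cr_norm CB (s := [::]) (leq0n r) px.
by case: cA => _ _ iA _; rewrite /= iA//; exact: (hP.2 p).2.
Qed.

Lemma Cr_norm_ge0 (x0 : T) B : Cr A r B -> 0 <= Cr_norm P r B.
Proof. by move=> CB; apply: le_trans (ler_norm_Cr_norm x0 CB). Qed.

Lemma Cr_continuous B : Cr A r B -> continuous B.
Proof.
move=> CB x; case: cA => cvA oA iA mA.
have : [set: T] x by []. rewrite -cvA => -[i _ xi].
apply: (@near_eq_continuous _ _ ((B \o chart_inv A i) \o chart_map A i)).
  by apply: filterS (open_nbhs_nbhs (conj (oA i).1 xi)) => y yi /=; rewrite iA.
apply: continuous_comp; first exact: mA.
by apply: (Ck_on_continuous (CB i)); exists x.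
Qed.

End Cr_norm.

(** * Sections and fibre means of observables on the product *)

Section sections_and_fiber_means.
Variables (R : realType) (X Y : ptopologicalType) (m n : nat).
Variables (AX : atlas R X m) (AY : atlas R Y n).
Variables (PX : patches AX) (PY : patches AY) (r : nat).
Hypotheses (cAX : charted AX) (cAY : charted AY).
Hypotheses (hPX : patch_cover PX) (hPY : patch_cover PY).
Variable B : X * Y -> R.
Hypothesis CB : Cr (product_atlas AX AY) r B.

Let cA := product_charted cAX cAY.
Let hP := product_patch_cover hPX hPY.
Let N := Cr_norm (product_patches PX PY) r B.

Lemma Cr_section x : Cr AY r (fun y => B (x, y)).
Proof.
move=> j; case: cAX => cvX _ iX _.
have : [set: X] x by []. rewrite -cvX => -[i _ xi].
have := Ck_on_slice (chart_map AX i x) (CB (i, j)).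
rewrite (_ : (fun u => _) = (fun y => B (x, y)) \o chart_inv AY j).
  by apply: Ck_on_sub => _ [y yj <-]; exists (x, y).
by apply/funext => u /=; rewrite row_mxKl row_mxKr iX.
Qed.

(** The partials of the section in patch [q] are read in the product patch [(p, q)], with [p]
    containing [x]; hence the constant 1. *)
Lemma Cr_norm_section x : Cr_norm PY r (fun y => B (x, y)) <= N.
Proof.
apply: (Cr_norm_le hPY point) => q s y sr qy; have [p px] := patch_of hPX x.
have sr' : (size (map (@rshift m n) s) <= r)%N by rewrite size_map.
have := @ler_Cr_norm _ _ _ _ (product_patches PX PY) r cA hP B (p, q) _ (x, y)
  CB sr' (conj px qy).
rewrite /= iter_partial_rshift.
rewrite (_ : (fun u => _) = (fun y => B (x, y)) \o chart_inv AY (patch_chart PY q)) //.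
apply/funext => u /=; rewrite row_mxKl row_mxKr.
by case: cAX => _ _ -> //; exact: (hPX.2 p).2.
Qed.

Variable nu : probability (borel Y) R.
Hypothesis cY : compact [set: Y].

Lemma joint_Ck_chart i : joint_Ck r (chart_map AX i @` chart_dom AX i) setT
  (fun v y => B (chart_inv AX i v, y)).
Proof.
apply: joint_Ck_cover => y; case: cAY => cvY oY iY mY.
have : [set: Y] y by []. rewrite -cvY => -[j _ yj].
exists (chart_dom AY j) => //.
apply: (joint_Ck_eq (b := fun v y => (B \o chart_inv (product_atlas AX AY) (i, j))
    (row_mx v (chart_map AY j y)))); first exact: (oY j).1.
  by move=> v y' y'j /=; rewrite row_mxKl row_mxKr iY.
apply: (joint_Ck_pullback _ _ (CB (i, j))); first exact: mY.
by move=> _ y' [x xi <-] y'j; exists (x, y').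
Qed.

Let opX i : open (chart_map AX i @` chart_dom AX i).
Proof. by case: cAX => _ oX _ _; exact: (oX i).2. Qed.

Lemma Cr_fiber_mean : Cr AX r (fun x => \int[nu]_y B (x, y)).
Proof. by move=> i; exact: (Ck_under_integral nu cY (@opX i) (joint_Ck_chart i)).1. Qed.

(** Each partial of the mean is the integral of a partial of [B]. Every [y] may use its own patch
    [q], the bound being the same for all, and integrating against a probability keeps it. *)
Lemma Cr_norm_fiber_mean : Cr_norm PX r (fun x => \int[nu]_y B (x, y)) <= N.
Proof.
apply: (Cr_norm_le hPX point) => p s x sr px.
set i := patch_chart PX p.
have xi : chart_dom AX i x by exact: (hPX.2 p).2.
have [_ H] := Ck_under_integral nu cY (@opX i) (joint_Ck_chart i).
have [cs ->] := H s (chart_map AX i x) (ex_intro2 _ _ x xi erefl) sr.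
apply: ler_norm_Rintegral; first exact: continuous_borel_measurable.
move=> y; have [q qy] := patch_of hPY y.
have sr' : (size (map (@lshift m n) s) <= r)%N by rewrite size_map.
have := @ler_Cr_norm _ _ _ _ (product_patches PX PY) r cA hP B (p, q) _ (x, y)
  CB sr' (conj px qy).
rewrite /= iter_partial_lshift.
rewrite (_ : (fun v => _) = fun v => B (chart_inv AX i v, y)) //.
apply/funext => v /=; rewrite row_mxKl row_mxKr.
by case: cAY => _ _ -> //; exact: (hPY.2 q).2.
Qed.

End sections_and_fiber_means.

(** * Composition with the flow maps on C^r *)

Section flow_composition.
Variables (R : realType) (Y : ptopologicalType) (n d : nat).
Variables (A : atlas R Y n) (P : patches A) (r : nat).
Hypotheses (hA : compact_manifold A) (hP : patch_cover P).
Variable G : 'rV[R]_d -> Y -> Y.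
Hypothesis sG : smooth_map (product_atlas (euclidean_atlas R d) A) A
  (fun p => G p.1 p.2).

Let cA : charted A.
Proof. by case: hA => _ _; exact: smooth_atlas_charted. Qed.

(** Time and space form one variable, so that jets are continuous in the time too and compactness
    can bound them over a set of times. Time derivatives only enlarge these jets. *)
Let flow_chart i j (w : 'rV[R]_(d + n)) : 'rV[R]_n :=
  chart_map A j (G (lsubmx w) (chart_inv A i (rsubmx w))).

Let flow_dom i j : set 'rV[R]_(d + n) :=
  [set w | (chart_map A i @` chart_dom A i) (rsubmx w) /\
    chart_dom A j (G (lsubmx w) (chart_inv A i (rsubmx w)))].

Lemma flow_dom_open i j : open (flow_dom i j).
Proof.
have [_ oA iA _] := cA; case: hA => _ _ [_ _ _ mA _].
rewrite openE => w [wi wj].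
have cw : {for w, continuous (fun w : 'rV[R]_(d + n) =>
    G (lsubmx w) (chart_inv A i (rsubmx w)))}.
  apply: (@continuous2_cvg _ _ _ _ (nbhs w) _ lsubmx
    (fun w => chart_inv A i (rsubmx w)) G).
      exact: (sG.1 (lsubmx w, chart_inv A i (rsubmx w))).
    exact: continuous_lsubmx.
  apply: (@continuous_comp _ _ _ rsubmx (chart_inv A i)).
    exact: continuous_rsubmx.
  by case: wi => y yi <-; exact: (mA i y yi).2.
apply: filterI.
  apply: continuous_rsubmx; apply: open_nbhs_nbhs; split=> //; exact: (oA i).2.
by apply: cw; apply: open_nbhs_nbhs; split=> //; exact: (oA j).1.
Qed.

Lemma flow_chart_Ck i j k l :
  Ck_on (W := R) k (flow_dom i j) (fun w => flow_chart i j w 0 l).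
Proof.
apply: (Ck_on_coord _ (@flow_dom_open i j)).
have [_ _ iA _] := cA.
apply: Ck_on_sub (sG.2 (tt, i) j k) => w [[y yi yE] wj].
exists (lsubmx w, y); last by rewrite /= yE hsubmxK.
by split=> //; rewrite /preimage /= -[y](iA i) // yE.
Qed.

Lemma Ck_on_flow_comp (M : R) : 0 <= M -> exists2 C, 0 <= C &
  forall i j s B, Cr A r B ->
    let U := [set u | flow_dom i j (row_mx s u)] in
    [/\ open U, Ck_on (W := R) r U ((B \o G s) \o chart_inv A i) &
    forall u, U u ->
      (forall l, jet_norm r (fun w => flow_chart i j w 0 l) (row_mx s u) <= M) ->
      jet_norm r ((B \o G s) \o chart_inv A i) u <=
      C * jet_norm r (B \o chart_inv A j)
            (chart_map A j (G s (chart_inv A i u)))].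
Proof.
move=> M0; have [C C0 HC] := @Ck_on_comp R n n r M M0.
exists C => // i j s B CB U; have [_ oA iA _] := cA.
have oU : open U.
  apply: open_comp (@flow_dom_open i j) => u _.
  by apply: continuous_row_mx; [exact: cst_continuous|exact: cvg_id].
have CH l : Ck_on (W := R) r U (fun u => flow_chart i j (row_mx s u) 0 l).
  exact: (Ck_on_slice s (@flow_chart_Ck i j r l)).
have UV u : U u -> (chart_map A j @` chart_dom A j) (flow_chart i j (row_mx s u)).
  by move=> [_ uj]; exists (G (lsubmx (row_mx s u)) (chart_inv A i (rsubmx (row_mx s u)))).
have [CgH JgH] := HC U _ (B \o chart_inv A j) (fun u => flow_chart i j (row_mx s u))
  oU (oA j).2 (CB j) CH UV.
have E u : U u -> ((B \o chart_inv A j) \o (fun u => flow_chart i j (row_mx s u))) u =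
    ((B \o G s) \o chart_inv A i) u.
  by move=> [_]; rewrite /flow_chart /= row_mxKl row_mxKr => uj; rewrite iA.
split=> //; first exact: (Ck_on_eq oU E).
move=> u Uu HM; rewrite -(jet_norm_eq r oU E Uu).
have -> : chart_map A j (G s (chart_inv A i u)) = flow_chart i j (row_mx s u).
  by rewrite /flow_chart row_mxKl row_mxKr.
apply: JgH => // l; apply: le_trans (HM l).
exact: (jet_norm_slice r (fun w => flow_chart i j w 0 l)).
Qed.

Lemma Cr_flow_comp s B : Cr A r B -> Cr A r (B \o G s).
Proof.
(* Only the differentiability clause is used, so the jet bound is taken to be 0. *)
move=> CB i; have [C _ HC] := Ck_on_flow_comp (lexx 0).
apply: Ck_on_local => _ [y yi <-]; have [cvA _ iA _] := cA.
have : [set: Y] (G s y) by []. rewrite -cvA => -[j _ yj].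
have [_ CU _] := HC i j s B CB; exists [set u | flow_dom i j (row_mx s u)] => //.
by split; rewrite ?row_mxKl row_mxKr ?iA//; exists y.
Qed.

Lemma Cr_norm_flow_comp (D : set 'rV[R]_d) : compact D ->
  exists2 K, 0 <= K & forall s B, D s -> Cr A r B ->
    Cr_norm P r (B \o G s) <= K * Cr_norm P r B.
Proof.
move=> cD; have [_ oA iA mA] := cA; have [hY _ _] := hA.
(* Pairs of a time in [D] and a point of patch [p] that the flow sends into patch [q]. Patches are
   closed because Y is Hausdorff, so [Z p q] is compact; finitely many such sets cover [D] times
   Y. *)
pose Z p q := (D `*` patch_set P p) `&` (fun z => G z.1 z.2) @^-1` patch_set P q.
have cZ p q : compact (Z p q).
  apply: compact_closedI.
    by apply: compact_setX => //; exact: (hP.2 p).1.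
  apply: preimage_closed; first by move=> z _; exact: sG.1.
  by apply: compact_closed => //; exact: (hP.2 q).1.
pose ic := patch_chart P.
have HM (pql : Defs.patch P * Defs.patch P * 'I_n) : exists M, 0 <= M /\
    forall s y, Z pql.1.1 pql.1.2 (s, y) ->
    jet_norm r (fun w => flow_chart (ic pql.1.1) (ic pql.1.2) w 0 pql.2)
      (row_mx s (chart_map A (ic pql.1.1) y)) <= M.
  case: pql => -[p q] l /=.
  have [[s y] [[/= Ds py] qy]|M M0 HM] := @compact_continuous_bounded R _ (Z p q)
    (fun z => jet_norm r (fun w => flow_chart (ic p) (ic q) w 0 l)
      (row_mx z.1 (chart_map A (ic p) z.2))) (cZ p q).
    have yp : chart_dom A (ic p) y by exact: (hP.2 p).2.
    apply: (@continuous_comp _ _ _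
      (fun z : 'rV[R]_d * Y => row_mx z.1 (chart_map A (ic p) z.2))
      (jet_norm r (fun w => flow_chart (ic p) (ic q) w 0 l))).
      apply: continuous_row_mx; first exact: cvg_fst.
      by apply: (@continuous_comp _ _ _ snd (chart_map A (ic p)));
        [exact: cvg_snd|exact: mA].
    apply: (jet_norm_continuous (@flow_chart_Ck (ic p) (ic q) r l)).
    split; rewrite /= row_mxKr; first by exists y.
    by rewrite row_mxKl iA//; exact: (hP.2 q).2.
  exists M; split=> // s y Zsy; apply: le_trans (HM _ Zsy); exact: ler_norm.
have [M {}HM] := choice HM.
pose MM := \sum_pql M pql.
have MM0 : 0 <= MM by apply: sumr_ge0 => pql _; exact: (HM pql).1.
have [C C0 HC] := Ck_on_flow_comp MM0.
(* [C] is the chain rule constant for jets bounded by [MM]; the sum converts the jet of [B] at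
   [G s y] into the supremum norm. *)
exists (C * \sum_(i < r.+1) n%:R ^+ i).
  by rewrite mulr_ge0// sumr_ge0// => i _; rewrite exprn_ge0.
move=> s B Ds CB; apply: (Cr_norm_le hP point) => p t y tr py.
have [q qy] := patch_of hP (G s y).
have yp : chart_dom A (ic p) y by exact: (hP.2 p).2.
have yq : chart_dom A (ic q) (G s y) by exact: (hP.2 q).2.
apply: (le_trans (ler_iter_partial_jet _ _ tr)).
have [_ _ J] := HC (ic p) (ic q) s B CB.
apply: (le_trans (J (chart_map A (ic p) y) _ _)).
- by split; rewrite /= row_mxKr; [exists y|rewrite row_mxKl iA].
- move=> l; apply: le_trans ((HM (p, q, l)).2 s y _) _; first by [].
  rewrite /MM (bigD1 (p, q, l))//= lerDl sumr_ge0// => pql _; exact: (HM pql).1.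
rewrite -mulrA ler_wpM2l// iA//.
apply: jet_norm_le_iter_partial => t' t'r.
exact: (ler_Cr_norm cA hP CB t'r qy).
Qed.

End flow_composition.

(** * Measurability and Tonelli *)

(** The first variable is frozen at the first centre in the list whose neighbourhood contains it;
    the default 0 is never reached once these neighbourhoods cover X. *)
Fixpoint step_approx (R : realType) (X Y : Type) (V : X -> set X)
    (B : X * Y -> R) (s : seq X) (z : X * Y) : R :=
  if s is x :: s' then
    if z.1 \in V x then B (x, z.2) else step_approx V B s' z
  else 0.

(* No second countability is needed: by compactness B is a uniform limit of
   functions which depend on the first variable through finitely many open
   sets only. *)
Lemma continuous_product_measurable (R : realType) (X Y : ptopologicalType)
    (B : X * Y -> R) :
  compact [set: X] -> compact [set: Y] -> continuous B ->
  measurable_fun [set: borel X * borel Y] B.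
Proof.
rewrite compact_cover => cX cY cB.
have H (k : nat) : exists g : X * Y -> R,
    measurable_fun [set: borel X * borel Y] g /\
    forall z, `|B z - g z| <= k.+1%:R^-1.
  have k0 : 0 < k.+1%:R^-1 :> R by rewrite invr_gt0.
  have HV x0 : exists V : set X, [/\ open V, V x0 &
      forall x y, V x -> `|B (x0, y) - B (x, y)| <= k.+1%:R^-1].
    have cB' y : {for (x0, y), continuous (fun p => B (p.1, p.2))}.
      by rewrite (_ : (fun _ => _) = B); [exact: cB|apply/funext => -[]].
    have : nbhs x0 [set x | forall y, `|B (x0, y) - B (x, y)| <= k.+1%:R^-1].
      exact: (tube (c := fun x y => B (x, y)) cY cB' k0).
    rewrite nbhsE => -[W [oW Wx0] HW].
    by exists W; split=> // x y /HW.
  have [V {}HV] := choice HV.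
  have [|x _|s _ sV] := cX X setT V.
  - by move=> x _; case: (HV x).
  - by exists x => //; case: (HV x).
  exists (step_approx V B (finmap.enum_fset s)); split.
    elim: (finmap.enum_fset s) => [|x t IH]; first exact: measurable_cst.
    apply: measurable_fun_ifT => //.
    - apply: (measurable_fun_bool true).
      rewrite setTI (_ : _ @^-1` _ = V x `*` setT).
        apply: measurableX => //; apply: sub_sigma_algebra; by case: (HV x).
      apply/seteqP; split=> -[u v] /= => [uV|[uV _]]; last exact: mem_set.
      by split=> //; exact: set_mem.
    - apply: (measurableT_comp (f := fun y : borel Y => B (x, y)) _ measurable_snd).
      apply: continuous_borel_measurable => y.
      apply: (continuous_comp (f := fun y => (x, y))); last exact: cB.
      by apply: cvg_pair; [exact: cvg_cst|exact: cvg_id].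
  move=> [x y]; have [i si Vi] := sV x Logic.I.
  have : exists2 i, i \in finmap.enum_fset s & V i x by exists i.
  elim: (finmap.enum_fset s) => [|x0 t IH] [j]; first by [].
  rewrite inE => /orP[/eqP->|jt] Vj /=; case: ifPn => xV.
  - by case: (HV x0) => _ _; rewrite distrC; apply; exact: set_mem.
  - by rewrite (mem_set Vj) in xV.
  - by case: (HV x0) => _ _; rewrite distrC; apply; exact: set_mem.
  - by apply: IH; exists j.
have [g Hg] := choice H.
apply: (@measurable_fun_cvg _ (borel X * borel Y)%type R setT
  (g : (borel X * borel Y -> R)^nat) B) => [k|z _]; first exact: (Hg k).1.
apply/cvgrPdist_le => e e0; near=> k.
apply: (le_trans ((Hg k).2 z)); apply: ltW; near: k.
exact: (near_infty_natSinv_lt (PosNum e0)).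
Unshelve. all: by end_near. Qed.

Lemma iter_skew_product (R : realType) (d : nat) (X Y : Type) (f : X -> X)
    (G : 'rV[R]_d -> Y -> Y) (tau : X -> 'rV[R]_d) N z :
  is_action G ->
  iter N (skew_product f G tau) z =
  (iter N f z.1, G (birkhoff_sum f tau N z.1) z.2).
Proof.
move=> [G0 GD]; elim: N => [|N IH].
  by rewrite /birkhoff_sum big_ord0 G0; case: z.
by rewrite iterS IH /skew_product /= /birkhoff_sum big_ord_recr /= addrC GD.
Qed.

Lemma measurable_coord (R : realType) d (i : 'I_d) :
  measurable_fun [set: borel 'rV[R]_d] (fun v : borel 'rV[R]_d => (v : 'rV[R]_d) 0 i).
Proof. by apply: continuous_borel_measurable; exact: coord_continuous. Qed.

Lemma measurable_coord_interval (R : realType) dT (T : measurableType dT) d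
    (g : 'I_d -> T -> R) (a b : 'I_d -> R) :
  (forall i, measurable_fun setT (g i)) ->
  measurable [set t | forall i, a i <= g i t <= b i].
Proof.
move=> mg.
rewrite (_ : [set _ | _] = \bigcap_(i in [set: 'I_d]) (g i @^-1` `[a i, b i])).
  apply: fin_bigcap_measurable => // i _; rewrite -[_ @^-1` _]setTI.
  by apply: mg => //; exact: measurable_itv.
by apply/seteqP; split=> t /= Ht i => [_|]; have := Ht i; rewrite /= in_itv /=; auto.
Qed.

Lemma sigma_finite_lebesgue_rV (R : realType) d :
  sigma_finite [set: borel 'rV[R]_d] (lebesgue_rV R d).
Proof.
exists (fun k : nat => [set v : 'rV[R]_d |
    forall i, (const_mx (- k%:R) : 'rV[R]_d) 0 i <= v 0 i <= (const_mx k%:R : 'rV[R]_d) 0 i]).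
  apply/esym/seteqP; split=> // v _.
  have [k vk] : exists k : nat, `|v| <= k%:R.
    by exists (Num.bound `|v|); apply: ltW; apply: archi_boundP.
  exists k => // i; rewrite !mxE -ler_norml.
  exact: le_trans (ler_norm_coord _ _) vk.
move=> k; split.
  by apply: (@measurable_coord_interval R _ (borel 'rV[R]_d)) => i; exact: measurable_coord.
rewrite [X in (X < _)%E](@lebesgue_rV_box R d) ?ltry// => i.
by rewrite !mxE lerNl (le_trans _ (ler0n _ _)) // oppr_le0.
Qed.

(** [lebesgue_rV] is declared as a plain measure, while Tonelli expects the sigma-finite structure;
    a copy carrying it is produced. *)
Lemma sigma_finite_structure (R : realType) d (T : measurableType d)
    (m : {measure set T -> \bar R}) : sigma_finite setT m ->
  exists m' : {sigma_finite_measure set T -> \bar R}, forall A, m' A = m A.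
Proof.
move=> mfin.
pose sfin := isSFinite.Build _ _ _ _ (sfinite_measure_sigma_finite mfin).
pose sigfin := isSigmaFinite.Build _ _ _ _ mfin.
by exists (HB.pack_for (SigmaFiniteMeasure.type T R) (Measure.sort m) sfin sigfin).
Qed.

Section Fubini_bounded.
Variables (R : realType) (d1 d2 : measure_display).
Variables (S : measurableType d1) (T : measurableType d2).
Variables (mu : probability S R) (nu : probability T R).

Lemma Rintegral_product (g : S * T -> R) (M : R) :
  measurable_fun setT g -> (forall z, `|g z| <= M) ->
  \int[(mu \x nu)%E]_z g z = \int[mu]_x \int[nu]_y g (x, y).
Proof.
move=> mg gM.
have ig : (mu \x nu)%E.-integrable setT (EFin \o g).
  exact: (@bounded_integrable _ _ _ (mu \x nu)%E _ M).
rewrite /Rintegral; congr fine; rewrite -integral12_prod_meas1//.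
apply: eq_integral => x _; rewrite /fubini_F fineK//.
apply: integrable_fin_num => //.
apply: (bounded_integrable nu (M := M) (f := fun y => g (x, y))) => //.
exact: measurableT_comp.
Qed.

End Fubini_bounded.

Lemma Rintegral_preserves (R : realType) d (T : measurableType d)
    (nu : probability T R) (f : T -> T) (g : T -> R) (M : R) :
  measurable_fun setT f -> preserves nu f ->
  measurable_fun setT g -> (forall x, `|g x| <= M) ->
  \int[nu]_x g (f x) = \int[nu]_x g x.
Proof.
move=> mf pf mg gM; rewrite /Rintegral; congr fine.
have ig : nu.-integrable (f @^-1` setT) ((EFin \o g) \o f).
  rewrite preimage_setT.
  exact: (bounded_integrable nu (measurableT_comp mg mf) (fun x => gM (f x))).
have := integral_pushforward mf _ ig measurableT.
rewrite preimage_setT => <-; last exact/measurable_EFinP.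
by apply: eq_measure_integral => A mA _; exact: (pf A mA).
Qed.

(** * Averaging the rate over unit cubes *)

Section kernel.
Variables (R : realType) (X : ptopologicalType) (mu : probability (borel X) R).
Variables (d : nat) (T : X -> 'rV[R]_d) (psi : 'rV[R]_d -> R).
Hypotheses (cT : continuous T) (psi0 : forall t, 0 <= psi t).
Hypothesis mpsi : measurable_fun [set: borel 'rV[R]_d] psi.

Definition cube (t : 'rV[R]_d) : set 'rV[R]_d :=
  [set u | forall i, (t - const_mx 2^-1) 0 i <= u 0 i <= (t + const_mx 2^-1) 0 i].

(** This symmetry turns a cube around the value of [T] into a cube located by the integration
    variable, to which anticoncentration applies. *)
Lemma cubeE t u : cube t u <-> unit_cube (u - const_mx 2^-1) t.
Proof.
by split=> H i; have := H i; rewrite !mxE => /andP[? ?]; apply/andP; split; lra.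
Qed.

Lemma cube_measurable t : measurable (cube t : set (borel 'rV[R]_d)).
Proof.
by apply: (@measurable_coord_interval R _ (borel 'rV[R]_d)) => i; exact: measurable_coord.
Qed.

Lemma lebesgue_cube t : lebesgue_rV R d (cube t) = 1%E.
Proof.
rewrite [LHS]lebesgue_rV_box => [|i]; last by rewrite !mxE; lra.
by congr EFin; apply: big1 => i _; rewrite !mxE; lra.
Qed.

Let mT i : measurable_fun [set: borel X] (fun x : borel X => T x 0 i).
Proof.
apply: continuous_borel_measurable => x.
apply: (@continuous_comp _ _ _ T (fun v : 'rV[R]_d => v 0 i)); first exact: cT.
exact: coord_continuous.
Qed.

Let S : set (borel X * borel 'rV[R]_d) := [set z | cube (T z.1) z.2].

Let mS : measurable S.
Proof.
(* Written with differences of coordinates, which are measurable on the product, the moving bounds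
   become constants. *)
rewrite (_ : S = [set z | forall i, - 2^-1 <= (z.2 : 'rV[R]_d) 0 i - T z.1 0 i <= 2^-1]).
  apply: (@measurable_coord_interval R _ (borel X * borel 'rV[R]_d)%type d
    (fun i z => (z.2 : 'rV[R]_d) 0 i - T z.1 0 i)) => i.
  apply: measurable_funB.
    exact: (measurableT_comp (measurable_coord i) measurable_snd).
  exact: (measurableT_comp (mT i) measurable_fst).
by apply/seteqP; split=> z H i; have := H i; rewrite /= !mxE => /andP[? ?];
  apply/andP; split; lra.
Qed.

Let Phi (z : borel X * borel 'rV[R]_d) : \bar R := (psi z.2 * \1_S z)%:E.

Let mPhi : measurable_fun setT Phi.
Proof.
apply/measurable_EFinP; apply: measurable_funM.
  exact: (measurableT_comp mpsi measurable_snd).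
exact: measurable_indic.
Qed.

Let Phi0 z : (0 <= Phi z)%E.
Proof. by rewrite lee_fin mulr_ge0. Qed.

(** Since [D x] is bounded by [C * psi u] for every [u] in a cube of volume 1, it is bounded by [C]
    times the integral of [psi] over that cube. Tonelli moves the integral over [x] inside, where it
    measures an event of probability at most [l]. *)
Lemma smoothing_bound (C l : R) (D : X -> R) :
  0 <= l -> 0 <= C -> measurable_fun [set: borel X] D -> (forall x, 0 <= D x) ->
  (forall x u, cube (T x) u -> D x <= C * psi u) ->
  (forall a, (mu [set x | unit_cube a (T x)] <= l%:E)%E) ->
  (\int[mu]_x (D x)%:E <=
    C%:E * (l%:E * \int[lebesgue_rV R d]_t (psi t)%:E))%E.
Proof.
move=> l0 C0 mD D0 DC Hmu.
have [m2 m2E] := sigma_finite_structure (sigma_finite_lebesgue_rV R d).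
rewrite (eq_measure_integral m2) => [|A _ _]; last exact: (esym (m2E A)).
have mPhix x : measurable_fun setT (fun t => Phi (x, t)).
  exact: measurableT_comp.
have mF : measurable_fun setT (fun x => \int[m2]_t Phi (x, t))%E.
  exact: (measurable_fun_fubini_tonelli_F (m2 := m2) Phi).
have mG : measurable_fun setT (fun t => \int[mu]_x Phi (x, t))%E.
  exact: (measurable_fun_fubini_tonelli_G (m1 := mu) Phi).
have step1 x : ((D x)%:E <= C%:E * \int[m2]_t Phi (x, t))%E.
  have -> : (D x)%:E = (\int[m2]_(t in cube (T x)) (D x)%:E)%E.
    transitivity ((D x)%:E * m2 (cube (T x)))%E.
      by rewrite m2E lebesgue_cube mule1.
    by rewrite integral_cst//; exact: cube_measurable.
  rewrite -ge0_integralZl_EFin//.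
  apply: (@le_trans _ _ (\int[m2]_(t in cube (T x)) (C%:E * Phi (x, t)))%E).
    apply: ge0_le_integral.
    - exact: cube_measurable.
    - by move=> t _; rewrite lee_fin.
    - exact: measurable_cst.
    - by apply: measurable_funTS; apply: measurable_funeM.
    - move=> t xt; rewrite -EFinM lee_fin indicE mem_set// mulr1.
      exact: DC.
  apply: ge0_subset_integral => //; first exact: cube_measurable.
    by apply: measurable_funeM.
  by move=> t _; rewrite mule_ge0// lee_fin.
have step2 : (\int[mu]_x \int[m2]_t Phi (x, t) = \int[m2]_t \int[mu]_x Phi (x, t))%E.
  exact: fubini_tonelli.
have step3 t : (\int[mu]_x Phi (x, t) <= l%:E * (psi t)%:E)%E.
  pose E : set (borel X) := [set x | unit_cube (t - const_mx 2^-1) (T x)].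
  have mE : measurable E by apply: measurable_coord_interval.
  rewrite (eq_integral (fun x => (psi t)%:E * (\1_E x)%:E)%E); last first.
    move=> x _; rewrite -EFinM /Phi !indicE; congr (_ * _%:R)%:E; congr nat_of_bool.
    apply/idP/idP => /set_mem h; apply/mem_set.
      exact: ((cubeE (T x) t).1 h).
    exact: ((cubeE (T x) t).2 h).
  rewrite ge0_integralZl_EFin//; last exact/measurable_EFinP/measurable_indic.
  rewrite integral_indic// setIT muleC.
  by apply: lee_wpmul2r; [rewrite lee_fin|exact: Hmu].
apply: (@le_trans _ _ (\int[mu]_x (C%:E * \int[m2]_t Phi (x, t)))%E).
  apply: ge0_le_integral => //.
  - by move=> x _; rewrite lee_fin.
  - exact/measurable_EFinP.
  - exact: measurable_funeM.
rewrite ge0_integralZl_EFin//; last by move=> x _; exact: integral_ge0.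
apply: lee_wpmul2l; first by rewrite lee_fin.
rewrite step2 -ge0_integralZl_EFin//; last exact/measurable_EFinP.
apply: ge0_le_integral => //.
- by move=> t _; exact: integral_ge0.
- by apply: measurable_funeM; exact/measurable_EFinP.
- by move=> t _; rewrite lee_fin.
Qed.

End kernel.

(** * Mixing of the skew product *)

(* For [L <= 1] the left alternative holds, otherwise the right one. *)
Lemma powR_min_rate (R : realType) (K1 K2 L alpha : R) (d : nat) :
  0 < L -> 0 < alpha -> 0 <= K1 -> 0 <= K2 ->
  2 <= (2 + K1 + K2) * L `^ (- Num.min d%:R alpha) \/
  K1 * L ^- d + K2 * L `^ (- alpha) <=
    (2 + K1 + K2) * L `^ (- Num.min d%:R alpha).
Proof.
move=> L0 alpha0 K10 K20; set m := Num.min _ _.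
have m0 : 0 <= m by rewrite le_min ler0n ltW.
have P0 : 0 <= L `^ (- m) by exact: powR_ge0.
have -> : (2 + K1 + K2) * L `^ (- m) =
    2 * L `^ (- m) + (K1 * L `^ (- m) + K2 * L `^ (- m)) by ring.
have [L1|L1] := leP L 1; [left|right].
  apply: (@le_trans _ _ (2 * L `^ (- m))); last by rewrite lerDl addr_ge0// mulr_ge0.
  rewrite ler_peMr//.
  rewrite -[leLHS](powRr0 L); apply: ger_powR; first by rewrite L0.
  by rewrite oppr_le0.
apply: ler_wpDl; first by rewrite mulr_ge0.
rewrite -powR_invn ?(ltW L0)//.
apply: lerD; rewrite ler_wpM2l//; apply: ler_powR; rewrite ?(ltW L1)// lerN2.
  by rewrite ge_min lexx.
by rewrite ge_min lexx orbT.
Qed.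

Lemma continuous_iter (T : topologicalType) (f : T -> T) N :
  continuous f -> continuous (iter N f).
Proof.
move=> cf; elim: N => [|N IH] x; first exact: cvg_id.
exact: (@continuous_comp _ _ _ (iter N f) f x (IH x) (cf _)).
Qed.

Lemma continuous_birkhoff_sum (R : realType) d (X : topologicalType)
    (f : X -> X) (tau : X -> 'rV[R]_d) N :
  continuous f -> continuous tau -> continuous (birkhoff_sum f tau N).
Proof.
move=> cf ctau x; apply: continuous_rV => j.
have -> : (fun t => birkhoff_sum f tau N t 0 j) =
    fun t => \sum_(n < N) tau (iter n f t) 0 j.
  by apply/funext => t; rewrite /birkhoff_sum summxE.
apply: for_continuous_sum => n.
apply: (@continuous_comp _ _ _ (tau \o iter n f) (fun v : 'rV[R]_d => v 0 j)).
  by apply: continuous_comp; [exact: continuous_iter|exact: ctau].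
exact: coord_continuous.
Qed.

Section correlations.
Variables (R : realType) (Y : ptopologicalType) (n d r : nat).
Variables (A : atlas R Y n) (P : patches A).
Hypotheses (hA : compact_manifold A) (hP : patch_cover P).
Variables (nu : probability (borel Y) R) (G : 'rV[R]_d -> Y -> Y).
Variable psi : 'rV[R]_d -> R.
Hypothesis aG : is_action G.
Hypothesis sG : smooth_map (product_atlas (euclidean_atlas R d) A) A
  (fun p => G p.1 p.2).
Hypothesis nuG : forall t, preserves nu (G t).
Hypothesis psi0 : forall t, 0 <= psi t.
Hypothesis mixG : mixing nu G psi (Cr A r) (Cr_norm P r).

(* The rate psi may be large on a null set, but composing with the flow for a
   time in a unit cube changes C^r norms by a bounded factor only, so the
   correlation at time t is controlled by psi at any nearby time u. *)
Lemma correlation_nearby_rate : exists2 C, 0 <= C &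
  forall t u B1 B2, cube t u -> Cr A r B1 -> Cr A r B2 ->
    `|\int[nu]_y (B1 y * B2 (G t y)) - \int[nu]_y B1 y * \int[nu]_y B2 y|
      <= C * psi u * Cr_norm P r B1 * Cr_norm P r B2.
Proof.
case: mixG => C HC; have [_ cY aA] := hA; have cA := smooth_atlas_charted aA.
pose D := [set s : 'rV[R]_d | forall i, `[- 2^-1, 2^-1]%classic (s ord0 i)].
have cD : compact D.
  exact: (@rV_compact R d (fun=> `[- 2^-1, 2^-1]%classic)
    (fun=> @segment_compact R _ _)).
have [K K0 HK] := Cr_norm_flow_comp r hA hP sG cD.
(* The constant in [mixing] may have either sign, hence the absolute value. *)
exists (`|C| * K) => [|t u B1 B2 tu C1 C2]; first by rewrite mulr_ge0.
have Ds : D (t - u).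
  move=> i; have := tu i; rewrite !mxE /= in_itv /= => /andP[? ?].
  by apply/andP; split; lra.
have GE y : G t y = G (t - u) (G u y) by rewrite -aG.2 subrK.
have CG := Cr_flow_comp hA sG (t - u) C2.
(* Mixing is used at time [u], the remaining time [t - u] being absorbed into the second observable.
   Invariance of [nu] leaves the mean of that observable unchanged. *)
have := HC B1 (B2 \o G (t - u)) C1 CG u.
have cGs : continuous (G (t - u)).
  move=> y; apply: (@continuous2_cvg _ _ _ _ (nbhs y) _ (fun=> t - u) id G).
      exact: (sG.1 (t - u, y)).
    exact: cst_continuous.
  exact: cvg_id.
have mGs : measurable_fun [set: borel Y] (G (t - u) : borel Y -> borel Y).
  apply: measurability; first by [].
  move=> _ [U oU <-].
  rewrite setTI; apply: sub_sigma_algebra.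
  by move/continuousP: cGs; apply.
have -> : \int[nu]_y (B2 \o G (t - u)) y = \int[nu]_y B2 y.
  have [M M0 HM] := compact_bounded_fun cY (Cr_continuous cA C2).
  apply: (Rintegral_preserves mGs (nuG _) _ HM).
  exact: continuous_borel_measurable (Cr_continuous cA C2).
under eq_Rintegral do rewrite /= -GE.
move=> /le_trans; apply.
have N1 := Cr_norm_ge0 cA hP point C1; have N2 := Cr_norm_ge0 cA hP point C2.
have NG := Cr_norm_ge0 cA hP point CG.
apply: (@le_trans _ _ (`|C| * psi u * Cr_norm P r B1 *
    Cr_norm P r (B2 \o G (t - u)))).
  by rewrite !ler_wpM2r// ler_norm.
rewrite (_ : `|C| * K * _ * _ * _ =
  `|C| * psi u * Cr_norm P r B1 * (K * Cr_norm P r B2)); last by ring.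
by rewrite ler_wpM2l ?mulr_ge0//; exact: HK.
Qed.

End correlations.

Theorem theorem4p6 (R : realType)
  (X Y : ptopologicalType) (dX dY : nat)
  (AX : atlas R X dX) (AY : atlas R Y dY) (PX : patches AX) (PY : patches AY)
  (hX : compact_manifold AX) (hY : compact_manifold AY)
  (hPX : patch_cover PX) (hPY : patch_cover PY) (r : nat) :
  exists w : nat,
    forall (d : nat)
      (f : X -> X) (mu : probability (borel X) R)
      (G : 'rV[R]_d -> Y -> Y) (nu : probability (borel Y) R)
      (tau : X -> 'rV[R]_d) (L : nat -> R) (alpha : R) (psiG : 'rV[R]_d -> R),
    smooth_map AX AX f -> preserves mu f ->
    is_action G ->
    smooth_map (product_atlas (euclidean_atlas R d) AY) AY
      (fun p => G p.1 p.2) ->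
    (forall t, preserves nu (G t)) ->
    smooth_map AX (euclidean_atlas R d) tau ->
    (forall n, 0 < L n) ->
    normalized_limit mu f tau L ->
    0 < alpha ->
    mixing mu (fun N => iter N f) (fun N => L N `^ (- alpha))
      (Cr AX r) (Cr_norm PX r) ->
    anticoncentration mu f tau L ->
    mixing nu G psiG (Cr AY r) (Cr_norm PY r) ->
    (forall t, 0 <= psiG t) ->
    measurable_fun [set: borel 'rV[R]_d] psiG ->
    (\int[lebesgue_rV R d]_t (psiG t)%:E < +oo)%E ->
    mixing (mu \x nu)%E (fun N => iter N (skew_product f G tau))
      (fun N => L N `^ (- Num.min d%:R alpha))
      (Cr (product_atlas AX AY) w) (Cr_norm (product_patches PX PY) w).
Proof.
exists r => d f mu G nu tau L alpha psiG sf _ aG sG nuG stau L0 _ alpha0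
  [Cf Hf] [CA CA0 HA] mixG psi0 mpsi Ipsi.
have [K K0 HK] := correlation_nearby_rate hY hPY aG sG nuG psi0 mixG.
have [_ cX aX] := hX; have [_ cY aY] := hY.
have cAX := smooth_atlas_charted aX; have cAY := smooth_atlas_charted aY.
have cA := product_charted cAX cAY; have hP := product_patch_cover hPX hPY.
pose I := fine (\int[lebesgue_rV R d]_t (psiG t)%:E)%E.
have I0 : 0 <= I by apply: fine_ge0; apply: integral_ge0 => t _; rewrite lee_fin.
have IE : (\int[lebesgue_rV R d]_t (psiG t)%:E = I%:E)%E.
  rewrite fineK// ge0_fin_numE//.
  by apply: integral_ge0 => t _; rewrite lee_fin.
(* The three terms come from the trivial bound, the cube average of the rate of [G], and mixing of
   [f]. *)
exists (2 + K * CA * I + `|Cf|) => B1 B2 C1 C2 N.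
set N1 := Cr_norm _ _ B1; set N2 := Cr_norm _ _ B2.
have N10 : 0 <= N1 by apply: (Cr_norm_ge0 cA hP (point, point)).
have N20 : 0 <= N2 by apply: (Cr_norm_ge0 cA hP (point, point)).
have B1N z : `|B1 z| <= N1 by apply: (ler_norm_Cr_norm cA hP).
have B2N z : `|B2 z| <= N2 by apply: (ler_norm_Cr_norm cA hP).
have cB1 := Cr_continuous cA C1; have cB2 := Cr_continuous cA C2.
pose T := birkhoff_sum f tau N; pose fN := iter N f.
have cT : continuous T by apply: continuous_birkhoff_sum; [exact: sf.1|exact: stau.1].
have cfN : continuous fN by apply: continuous_iter; exact: sf.1.
pose FN (z : X * Y) := (fN z.1, G (T z.1) z.2).
have cFN : continuous FN.
  move=> z; apply: cvg_pair.
    by apply: (@continuous_comp _ _ _ fst fN); [exact: cvg_fst|exact: cfN].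
  apply: (@continuous2_cvg _ _ _ _ (nbhs z) _ (T \o fst) snd G).
  - exact: (sG.1 (T z.1, z.2)).
  - by apply: (@continuous_comp _ _ _ fst T); [exact: cvg_fst|exact: cT].
  - exact: cvg_snd.
pose g z := B1 z * B2 (FN z).
have cg : continuous g.
  move=> z; apply: continuousM; first exact: cB1.
  by apply: continuous_comp; [exact: cFN|exact: cB2].
have gN z : `|g z| <= N1 * N2 by rewrite normrM ler_pM.
pose b1 x := \int[nu]_y B1 (x, y); pose b2 x := \int[nu]_y B2 (x, y).
pose c x := \int[nu]_y g (x, y).
have Cb1 : Cr AX r b1 := Cr_fiber_mean cAX cAY C1 nu cY.
have Cb2 : Cr AX r b2 := Cr_fiber_mean cAX cAY C2 nu cY.
have b1N : Cr_norm PX r b1 <= N1 := Cr_norm_fiber_mean cAX cAY hPX hPY C1 nu cY.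
have b2N : Cr_norm PX r b2 <= N2 := Cr_norm_fiber_mean cAX cAY hPX hPY C2 nu cY.
have cb1 := Cr_continuous cAX Cb1; have cb2 := Cr_continuous cAX Cb2.
have cc : continuous c.
  move=> x; have := @continuous_under_integral R Y nu cY X (fun x y => g (x, y)) x.
  apply; apply: nearW => x' y; rewrite (_ : (fun _ => _) = g); first exact: cg.
  by apply/funext => -[].
(* The fibre correlation at time [T x] between the section of [B1] at [x] and that of [B2] at
   [fN x]. *)
pose D x := c x - b1 x * b2 (fN x).
have cD : continuous D.
  move=> x; apply: continuousB; first exact: cc.
  apply: continuousM; first exact: cb1.
  by apply: continuous_comp; [exact: cfN|exact: cb2].
have mprod (B : X * Y -> R) : continuous B -> measurable_fun [set: borel X * borel Y] B.
  exact: continuous_product_measurable.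
have -> : \int[(mu \x nu)%E]_z (B1 z * B2 (iter N (skew_product f G tau) z)) =
    \int[mu]_x c x.
  rewrite -(Rintegral_product mu nu (mprod _ cg) gN).
  by apply: eq_Rintegral => z _; rewrite iter_skew_product.
have -> : \int[(mu \x nu)%E]_z B1 z = \int[mu]_x b1 x.
  exact: (Rintegral_product mu nu (mprod _ cB1) B1N).
have -> : \int[(mu \x nu)%E]_z B2 z = \int[mu]_x b2 x.
  exact: (Rintegral_product mu nu (mprod _ cB2) B2N).
have mb (h : X -> R) : continuous h -> measurable_fun [set: borel X] h.
  exact: continuous_borel_measurable.
have bnd1 x : `|b1 x| <= N1.
  by apply: le_trans (ler_norm_Cr_norm cAX hPX x Cb1) b1N.
have bnd2 x : `|b2 x| <= N2.
  by apply: le_trans (ler_norm_Cr_norm cAX hPX x Cb2) b2N.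
have Dpsi x u : cube (T x) u -> `|D x| <= (K * N1 * N2) * psiG u.
  move=> xu.
  have S1 := Cr_section cAX C1 x; have S2 := Cr_section cAX C2 (fN x).
  apply: (le_trans (HK (T x) u _ _ xu S1 S2)).
  rewrite (_ : K * N1 * N2 * psiG u = K * psiG u * N1 * N2); last by ring.
  have n1 := Cr_norm_section cAX cAY hPX hPY C1 x.
  have n2 := Cr_norm_section cAX cAY hPX hPY C2 (fN x).
  have s1 := Cr_norm_ge0 cAY hPY point S1; have s2 := Cr_norm_ge0 cAY hPY point S2.
  by apply: ler_pM => //; rewrite ?mulr_ge0// ler_wpM2l// mulr_ge0.
have [M M0 DM] := compact_bounded_fun cX cD.
have iD := bounded_integrable mu (mb _ cD) DM.
have int_D : `|\int[mu]_x D x| <= K * CA * I * L N ^- d * (N1 * N2).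
  rewrite -lee_fin EFin_normr_Rintegral//.
  apply: (le_trans (le_abse_integral mu measurableT (measurable_int _ iD))).
  have l0 : 0 <= CA * L N ^- d.
    by rewrite mulr_ge0 ?(ltW CA0)// invr_ge0 exprn_ge0// ltW.
  have KN : 0 <= K * N1 * N2 by rewrite !mulr_ge0.
  have := smoothing_bound cT psi0 mpsi (D := fun x => `|D x|) l0 KN
    (measurableT_comp (@normr_measurable _ _) (mb _ cD)) (fun x => normr_ge0 _)
    Dpsi (fun a => HA a N).
  rewrite IE => /le_trans; apply.
  by rewrite -!EFinM lee_fin le_eqVlt; apply/orP; left; apply/eqP; ring.
pose E := \int[mu]_x (b1 x * b2 (fN x)).
have cE : continuous (fun x => b1 x * b2 (fN x)).
  move=> x; apply: continuousM; first exact: cb1.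
  by apply: continuous_comp; [exact: cfN|exact: cb2].
have cN x : `|c x| <= N1 * N2.
  apply: ler_norm_Rintegral => [|y]; last exact: gN.
  apply: continuous_borel_measurable; apply: (section_continuous (c := fun x y => g (x, y))).
  move=> y; rewrite (_ : (fun _ => _) = g); first exact: cg.
  by apply/funext => -[].
have EN x : `|b1 x * b2 (fN x)| <= N1 * N2 by rewrite normrM ler_pM.
(* The full correlation splits into the integrated fibre correlation and the base correlation [E] of
   the fibre means. *)
have int_c : \int[mu]_x c x = \int[mu]_x D x + E.
  rewrite /D RintegralB ?subrK//.
    exact: (bounded_integrable mu (mb _ cc) cN).
  exact: (bounded_integrable mu (mb _ cE) EN).
have mix_f : `|E - \int[mu]_x b1 x * \int[mu]_x b2 x| <=
    `|Cf| * L N `^ (- alpha) * (N1 * N2).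
  apply: (le_trans (Hf b1 b2 Cb1 Cb2 N)).
  have LP := powR_ge0 (L N) (- alpha).
  have n1 := Cr_norm_ge0 cAX hPX point Cb1; have n2 := Cr_norm_ge0 cAX hPX point Cb2.
  apply: (@le_trans _ _ (`|Cf| * L N `^ (- alpha) *
      Cr_norm PX r b1 * Cr_norm PX r b2)).
    by rewrite !ler_wpM2r// ler_norm.
  by rewrite -mulrA ler_wpM2l ?mulr_ge0//; exact: ler_pM.
have triv : `|\int[mu]_x c x - \int[mu]_x b1 x * \int[mu]_x b2 x| <= 2 * (N1 * N2).
  rewrite mulr2n mulrDl mul1r; apply: (le_trans (ler_normB _ _)); apply: lerD.
    exact: (ler_norm_Rintegral mu (mb _ cc) cN).
  rewrite normrM; apply: ler_pM => //.
    exact: (ler_norm_Rintegral mu (mb _ cb1) bnd1).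
  exact: (ler_norm_Rintegral mu (mb _ cb2) bnd2).
rewrite -mulrA.
have K10 : 0 <= K * CA * I by rewrite !mulr_ge0// ltW.
have [B|B] := @powR_min_rate R (K * CA * I) `|Cf| (L N) alpha d (L0 N) alpha0 K10 (normr_ge0 _).
  by apply: (le_trans triv); rewrite ler_wpM2r// mulr_ge0.
apply: (@le_trans _ _ ((K * CA * I * L N ^- d + `|Cf| * L N `^ (- alpha)) * (N1 * N2))).
  rewrite mulrDl int_c -addrA.
  by apply: (le_trans (ler_normD _ _)); exact: lerD.
by rewrite ler_wpM2r// mulr_ge0.
Qed.
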